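(* Let $d\geqslant 2$ be an integer, $\mu>-1$ and $\lambda>0$. For each integer $k\geqslant 0$ let $\{Y_\nu^{k}:1\le\nu\le a_{k}^d\}$ be an orthonormal basis of $\mathcal{H}_{k}^d$, and put $$\beta_k=k+\frac{d-2}{2},\qquad c_\mu^d=\frac{1}{2^{\mu+\frac d2+1}}\frac{\sigma_{d-1}}{\omega_\mu},\qquad M_k=\lambda\frac{2^k}{c_\mu^d}.$$ For $n\in\mathbb{N}_0$ and $0\le j\le n/2$ let $q_j^{(\mu,\beta_{n-2j},M_{n-2j})}(t)$ be the $j$-th orthogonal polynomial in one variable with respect to $$(f,g)_{\mu,\beta_{n-2j}}^{M_{n-2j}}=\int_{-1}^1f(t)g(t)(1-t)^\mu(1+t)^{\beta_{n-2j}}\,dt+M_{n-2j}f(1)g(1),$$ normalized to have the same leading coefficient as the Jacobi polynomial $P_j^{(\mu,\beta_{n-2j})}(t)$. Define $$Q_{j,\nu}^n(x)=q_j^{(\mu,\beta_{n-2j},M_{n-2j})}(2\|x\|^2-1)\,Y_\nu^{n-2j}(x).$$ Then, for each $n$, the polynomials $Q_{j,\nu}^n$ with $0\le j\le n/2$, $1\le\nu\le a_{n-2j}^d$, constitute a mutually orthogonal basis of $\mathcal{V}_n^d(W_\mu,\lambda)$. That is, $$\langle Q_{j,\nu}^n,Q_{k,\eta}^m\rangle_\mu^\lambda=\tilde H_{j,\nu}^n\,\delta_{n,m}\,\delta_{j,k}\,\delta_{\nu,\eta},$$ where $$\tilde H_{j,\nu}^n=\frac{c_\mu^d}{2^{n-2j}}\,\tilde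 h_j^{(\mu,\beta_{n-2j},M_{n-2j})},\qquad \tilde h_j^{(\mu,\beta_{n-2j},M_{n-2j})}=\left(q_j^{(\mu,\beta_{n-2j},M_{n-2j})},q_j^{(\mu,\beta_{n-2j},M_{n-2j})}\right)_{\mu,\beta_{n-2j}}^{M_{n-2j}}.$$
   Context: $\mathbb{B}^d=\{x\in\mathbb{R}^d:\|x\|\leqslant 1\}$ and $\mathbb{S}^{d-1}=\{\xi\in\mathbb{R}^d:\|\xi\|=1\}$ with the Euclidean norm; $d\sigma$ is the surface measure on $\mathbb{S}^{d-1}$ and $\sigma_{d-1}=\int_{\mathbb{S}^{d-1}}d\sigma=2\pi^{d/2}/\Gamma(d/2)$. $W_\mu(x)=(1-\|x\|^2)^\mu$ and $\omega_\mu=\int_{\mathbb{B}^d}W_\mu(x)\,dx=\pi^{d/2}\Gamma(\mu+1)/\Gamma(\mu+1+d/2)$. The inner product on real polynomials in $d$ variables is $$\langle f,g\rangle_\mu^\lambda=\frac1{\omega_\mu}\int_{\mathbb{B}^d}f(x)g(x)W_\mu(x)\,dx+\frac{\lambda}{\sigma_{d-1}}\int_{\mathbb{S}^{d-1}}f(\xi)g(\xi)\,d\sigma(\xi).$$ $\mathcal{V}_n^d(W_\mu,\lambda)$ is the linear space of orthogonal polynomials of degree $n$ for this inner product, i.e. the polynomials $P$ of total degree at most $n$ with $\langle P,Q\rangle_\mu^\lambda=0$ for all polynomials $Q$ of total degree at most $n-1$. $\mathcal{H}_k^d$ is the space of homogeneous harmonic polynomials of degree $k$ in $d$ variables, $a_k^d=\dim\mathcal{H}_k^d$,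 and orthonormality of bases of $\mathcal{H}_k^d$ is with respect to $\langle f,g\rangle_{\mathbb{S}^{d-1}}=\frac{1}{\sigma_{d-1}}\int_{\mathbb{S}^{d-1}}f(\xi)g(\xi)\,d\sigma(\xi)$. $P_j^{(\alpha,\beta)}$ is the Jacobi polynomial of degree $j$, orthogonal on $[-1,1]$ with respect to $(1-t)^\alpha(1+t)^\beta$ and normalized by $P_j^{(\alpha,\beta)}(1)=\binom{j+\alpha}{j}=\frac{(\alpha+1)_j}{j!}$. A basis is mutually orthogonal if its distinct elements are orthogonal to each other. *)

(* Defs.v *)
From HB Require Import structures.
From mathcomp Require Import all_boot all_order all_algebra.
(* The notations of mpoly clash with those of analysis, and its module Measure
   must not shadow the one of analysis, hence the import order. *)
From mathcomp Require Import -(notations) mpoly.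
From mathcomp Require Import all_classical all_reals all_analysis.
From mathcomp Require Import measurable_realfun.

Set Implicit Arguments.
Unset Strict Implicit.
Unset Printing Implicit Defensive.
Import Order.TTheory GRing.Theory Num.Theory.
Import numFieldNormedType.Exports.

Local Open Scope classical_set_scope.
Local Open Scope ring_scope.

Notation euclid R d := (d.-tuple (measurableTypeR R)).

Section lebesgue_cons.
Context (R : realType) (d : nat).
Variable m : {sigma_finite_measure set (euclid R d) -> \bar R}.

Definition tuple_cons (p : measurableTypeR R * euclid R d) : euclid R d.+1 :=
  [tuple of p.1 :: p.2].

Lemma measurable_tuple_cons : measurable_fun [set: _] tuple_cons.
Proof. exact: (measurable_cons measurable_fst measurable_snd). Qed.

Definition lebesgue_cons : set (euclid R d.+1) -> \bar R :=
  pushforward (@lebesgue_measure R \x m)%E tuple_cons.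

Let lebesgue_cons0 : lebesgue_cons set0 = 0%E.
Proof. by rewrite /lebesgue_cons /pushforward preimage_set0 measure0. Qed.

Let lebesgue_cons_ge0 A : (0 <= lebesgue_cons A)%E.
Proof. exact: (measure_ge0 (@lebesgue_measure R \x m)%E). Qed.

Let lebesgue_cons_sigma_additive : semi_sigma_additive lebesgue_cons.
Proof.
have mc := measurable_tuple_cons.
have mpre A : measurable A -> measurable (tuple_cons @^-1` A).
  by move=> mA; rewrite -[X in measurable X]setTI; exact: mc.
move=> F mF tF mUF; rewrite /lebesgue_cons /pushforward preimage_bigcup.
apply: measure_semi_sigma_additive => [n||].
- exact: mpre.
- by move=> i j _ _ [p [Fip Fjp]]; apply: tF => //; exists (tuple_cons p).
- by rewrite -preimage_bigcup; exact: mpre.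
Qed.

HB.instance Definition _ := isMeasure.Build _ _ _ lebesgue_cons
  lebesgue_cons0 lebesgue_cons_ge0 lebesgue_cons_sigma_additive.

Let lebesgue_cons_sigma_finite : sigma_finite setT lebesgue_cons.
Proof.
have /sigma_finiteP[F [FT ndF F_fin]] := sigma_finiteT (@lebesgue_measure R).
have /sigma_finiteP[G [GT ndG G_fin]] := sigma_finiteT m.
pose uncons (t : euclid R d.+1) : measurableTypeR R * euclid R d :=
  (thead t, [tuple of behead t]).
have muncons : measurable_fun setT uncons.
  apply/measurable_fun_pairP; split; first exact: measurable_tnth.
  exact: measurable_behead.
exists (fun n => uncons @^-1` (F n `*` G n)).
  apply/esym; rewrite -subTset => t _.
  have [k _ Fk] : (\bigcup_n F n) (thead t) by rewrite -FT.
  have [l _ Gl] : (\bigcup_n G n) [tuple of behead t] by rewrite -GT.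
  exists (maxn k l) => //; split.
  - by move: Fk; exact/subsetPset/ndF/leq_maxl.
  - by move: Gl; exact/subsetPset/ndG/leq_maxr.
move=> n; have [mF Foo] := F_fin n; have [mG Goo] := G_fin n; split.
  by rewrite -[X in measurable X]setTI; apply: muncons => //; exact: measurableX.
rewrite /lebesgue_cons /pushforward (_ : _ @^-1` _ = F n `*` G n).
  by rewrite product_measure1E// lte_mul_pinfty// ge0_fin_numE.
rewrite -comp_preimage (_ : uncons \o tuple_cons = id)//.
by apply/funext => -[x t]; congr pair; exact/val_inj.
Qed.

HB.instance Definition _ := Measure_isSigmaFinite.Build _ _ _ lebesgue_cons
  lebesgue_cons_sigma_finite.

End lebesgue_cons.

Fixpoint lebesgue (R : realType) (d : nat) :
    {sigma_finite_measure set (euclid R d) -> \bar R} :=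
  match d with
  | 0 => dirac [tuple]
  | d'.+1 => lebesgue_cons (lebesgue R d')
  end.

Section sphere.
Context (R : realType) (d : nat).

Definition enorm (x : euclid R d) : R := Num.sqrt (\sum_i (tnth x i : R) ^+ 2).

Definition unit_ball : set (euclid R d) := [set x | enorm x <= 1].

Definition unit_sphere : set (euclid R d) := [set x | enorm x = 1].

(* x / |x|, with the value 0 at x = 0 *)
Definition direction (x : euclid R d) : euclid R d :=
  [tuple ((enorm x)^-1 * tnth x i : measurableTypeR R) | i < d].

Lemma measurable_enorm : measurable_fun [set: euclid R d] enorm.
Proof.
rewrite (_ : enorm = fun x => (\sum_i (tnth x i : R) ^+ 2) `^ 2^-1).
  apply: (@measurableT_comp _ _ _ _ _ _ (@powR R ^~ 2^-1)).
    exact: measurable_powR.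
  apply: measurable_sum => i; apply: measurable_funX.
  exact: measurable_tnth.
apply/funext => x; rewrite powR12_sqrt// sumr_ge0// => i _.
exact: sqr_ge0.
Qed.

Lemma measurable_unit_ball : measurable unit_ball.
Proof.
rewrite (_ : unit_ball = enorm @^-1` `]-oo, 1]).
  by rewrite -[X in measurable X]setTI; exact: measurable_enorm.
by apply/seteqP; split => x; rewrite /unit_ball /= in_itv.
Qed.

Lemma measurable_direction : measurable_fun [set: euclid R d] direction.
Proof.
apply/measurable_fun_tnthP => i.
rewrite (_ : _ \o _ = fun x => enorm x `^ (-1) * (tnth x i : R)).
  apply: measurable_funM; last exact: measurable_tnth.
  apply: (@measurableT_comp _ _ _ _ _ _ (@powR R ^~ (-1)) _ enorm).
    exact: measurable_powR.
  exact: measurable_enorm.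
by apply/funext => x /=; rewrite tnth_mktuple powR_inv1// sqrtr_ge0.
Qed.

(* The surface measure of A `<=` unit_sphere is d times the volume of the cone
   {r *: xi | 0 < r <= 1, xi \in A}, i.e. the measure that makes
   dx = r ^ (d - 1) dr dsigma(xi) hold; its total mass is d times the volume of
   the unit ball. *)
Definition surface_measure (A : set (euclid R d)) : \bar R :=
  (d%:R%:E * lebesgue R d (unit_ball `&` direction @^-1` A))%E.

Let surface_measureE : surface_measure =
  mscale d%:R%:nng (measure_function_pushforward__canonical__measure_function_Measure
    (mrestr (lebesgue R d) measurable_unit_ball) measurable_direction).
Proof.
by apply/funext => A; rewrite /surface_measure setIC.
Qed.

Let surface_measure0 : surface_measure set0 = 0%E.
Proof. by rewrite surface_measureE measure0. Qed.

Let surface_measure_ge0 A : (0 <= surface_measure A)%E.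
Proof. by rewrite surface_measureE measure_ge0. Qed.

Let surface_measure_sigma_additive : semi_sigma_additive surface_measure.
Proof. by rewrite surface_measureE; exact: measure_semi_sigma_additive. Qed.

HB.instance Definition _ := isMeasure.Build _ _ _ surface_measure
  surface_measure0 surface_measure_ge0 surface_measure_sigma_additive.

End sphere.

Section inner_products.
Context (R : realType) (d : nat).
Implicit Types (f g : mpoly d R) (mu lambda : R).

Definition peval f (x : euclid R d) : R := meval (tnth x) f.

(* sigma_(d-1) *)
Definition sphere_area : R :=
  \int[@surface_measure R d]_(x in @unit_sphere R d) 1.

Definition weight mu (x : euclid R d) : R := (1 - enorm x ^+ 2) `^ mu.

(* omega_mu *)
Definition ball_mass mu : R :=
  \int[lebesgue R d]_(x in @unit_ball R d) weight mu x.

Definition sphere_ip f g : R :=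
  sphere_area^-1 *
  \int[@surface_measure R d]_(x in @unit_sphere R d) (peval f x * peval g x).

(* <f, g>_mu^lambda *)
Definition ball_ip mu lambda f g : R :=
  (ball_mass mu)^-1 *
    \int[lebesgue R d]_(x in @unit_ball R d)
      (peval f x * peval g x * weight mu x) +
  lambda / sphere_area *
    \int[@surface_measure R d]_(x in @unit_sphere R d) (peval f x * peval g x).

(* V_n^d(W_mu, lambda); msize is the total degree plus 1, and 0 at 0. *)
Definition orthopolys mu lambda (n : nat) : set (mpoly d R) :=
  [set f | (msize f <= n.+1)%N /\
           forall g, (msize g <= n)%N -> ball_ip mu lambda f g = 0].

Definition laplacian f : mpoly d R := \sum_(i < d) mderiv i (mderiv i f).

(* H_k^d *)
Definition harmonics (k : nat) : set (mpoly d R) :=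
  [set f | f \is ishomog1 k mdeg /\ laplacian f = 0].

(* p(2 |x|^2 - 1) *)
Definition radial (p : {poly R}) : mpoly d R :=
  (map_poly (@mpolyC d R) p).[2 *: (\sum_(i < d) mpolyX R (mnm1 i) ^+ 2) - 1].

End inner_products.

(* S is meant to be a linear subspace of V; V may have infinite dimension. *)
Definition is_basis (K : fieldType) (V : lmodType K) (I : finType)
    (S : set V) (e : I -> V) : Prop :=
  [/\ forall i, S (e i),
      forall c : I -> K, \sum_i c i *: e i = 0 -> forall i, c i = 0 &
      forall v, S v -> exists c : I -> K, v = \sum_i c i *: e i].

Section univariate.
Context (R : realType).
Implicit Types (alpha beta M : R) (f g p : {poly R}).

Definition jacobi_ip alpha beta f g : R :=
  \int[@lebesgue_measure R]_(t in `[-1, 1])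
    (f.[t] * g.[t] * (1 - t) `^ alpha * (1 + t) `^ beta).

(* (f, g)_(alpha, beta)^M *)
Definition jacobi_mass_ip alpha beta M f g : R :=
  jacobi_ip alpha beta f g + M * f.[1] * g.[1].

Definition is_orthopoly (ip : {poly R} -> {poly R} -> R) (j : nat) p : Prop :=
  size p = j.+1 /\ forall g, (size g <= j)%N -> ip p g = 0.

(* p = P_j^(alpha, beta) *)
Definition is_jacobi alpha beta (j : nat) p : Prop :=
  is_orthopoly (jacobi_ip alpha beta) j p /\
  p.[1] = (\prod_(i < j) (alpha + 1 + i%:R)) / j`!%:R.

End univariate.

Section ball_basis.
Context (R : realType) (d : nat).
Implicit Types (mu lambda : R) (k n j : nat).

Definition beta_ k : R := k%:R + (d%:R - 2) / 2.

Definition c_ mu : R :=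
  (2 `^ (mu + d%:R / 2 + 1))^-1 * (sphere_area R d / ball_mass d mu).

Definition M_ mu lambda k : R := lambda * (2 ^+ k / c_ mu).

(* q_j^(mu, beta_k, M_k) is written q k j below. *)
Implicit Type q : nat -> nat -> {poly R}.

(* Q_(j,nu)^n, where Y k enumerates a basis of H_k^d *)
Definition ball_poly (a : nat -> nat) (Y : forall k, 'I_(a k) -> mpoly d R) q
    n j (nu : 'I_(a (n - 2 * j)%N)) : mpoly d R :=
  radial d (q (n - 2 * j)%N j) * Y (n - 2 * j)%N nu.

Definition h_tilde mu lambda q k j : R :=
  jacobi_mass_ip mu (beta_ k) (M_ mu lambda k) (q k j) (q k j).

Definition H_tilde mu lambda q n j : R :=
  c_ mu / 2 ^+ (n - 2 * j) * h_tilde mu lambda q (n - 2 * j)%N j.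

End ball_basis.

(* Main.v *)
(** In polar form, with t = 2|x|^2 - 1 and xi = x/|x|, Lebesgue measure on the
    ball is the product of 2^(-(d/2+1)) (1+t)^((d-2)/2) dt on [-1,1] and the
    surface measure: both agree on the sets {t <= s, xi in A} because Lebesgue
    measure is homogeneous of degree d.  As a homogeneous polynomial of degree k
    is |x|^k times a function of xi, the inner product of two Q's splits into a
    Jacobi integral with a point mass at t = 1 and an integral of Y Y' over the
    sphere.

    Harmonics of different degrees are orthogonal on the sphere: integrating
    the partial derivative of x^m (1 - |x|^2) over the ball along a single
    coordinate line gives
      int_S d_i f = (m + d - 1) int_S x_i f
    for f homogeneous of degree m, and this identity applied to
    f = h d_i g - g d_i h, summed over i, is Green's formula.

    The Q's of degree at most n span all polynomials of degree at most n by the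
    Fischer decomposition f = sum_j |x|^(2j) h_j with h_j harmonic.  Hence every
    polynomial equals its Fourier sum in the Q's, which reduces to the terms of
    degree n for a polynomial of V_n. *)

Require Import Defs.
From HB Require Import structures.
From mathcomp Require Import all_boot all_order all_algebra.
From mathcomp Require Import -(notations) mpoly.
From mathcomp Require Import all_classical all_reals all_analysis.
From mathcomp Require Import measurable_realfun.
From mathcomp Require Import ring lra zify.
Import Order.TTheory GRing.Theory Num.Theory.
Import numFieldNormedType.Exports.

Set Implicit Arguments.
Unset Strict Implicit.
Unset Printing Implicit Defensive.

Local Open Scope classical_set_scope.
Local Open Scope ring_scope.

(** * Scaling of Lebesgue measure *)

(** The surface measure is defined through volumes of cones, so integration in polar coordinates has
    to be derived from Lebesgue measure on tuples. The variable t replaces the radius because (1 +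
    t)/2 = |x|^2 and (1 - t)/2 = 1 - |x|^2, which produces the Jacobi weight at once. The powers of
    2 have three sources: r^(d-1) dr gives 2^(-(d/2+1)), the weight W_mu gives 2^(-mu), and |x|^(2k)
    gives 2^(-k). The first two, together with sigma_(d-1)/omega_mu, make up c_mu, and M_k is the
    solution of c_mu 2^(-k) M_k = lambda. Green's formula is obtained without calculus on the
    sphere. The factor 1 - |x|^2 vanishes on the boundary, so the volume integral of a partial
    derivative is 0; its terms are homogeneous, so radial integration turns this into a relation
    between integrals over the sphere. The normalizations must be nonzero: for sigma_(d-1) this
    follows from the orthonormal basis in degree 0, and omega_mu is sigma_(d-1) times a positive
    Jacobi integral. *)

Definition pushforward_measure d1 d2 (T1 : measurableType d1) (T2 : measurableType d2)
    (R : realType) (m : {measure set T1 -> \bar R}) (f : T1 -> T2)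
    (mf : measurable_fun setT f) : {measure set T2 -> \bar R} :=
  measure_function_pushforward__canonical__measure_function_Measure m mf.

Section scaling.
Variable R : realType.
Local Notation leb := (@lebesgue_measure R).
Implicit Type r : R.

Definition scale_tuple d r (x : euclid R d) : euclid R d :=
  [tuple (r * tnth x i : measurableTypeR R) | i < d].

Lemma measurable_scale_tuple d r :
  measurable_fun [set: euclid R d] (scale_tuple r).
Proof.
apply/measurable_fun_tnthP => i.
rewrite (_ : _ \o _ = fun x => r * (tnth x i : R)).
  apply: measurable_funM; [exact: measurable_cst|exact: measurable_tnth].
by apply/funext => x /=; rewrite tnth_mktuple.
Qed.

(** The image of [leb] under multiplication by [r], multiplied by [r], gives each interval ]a, b]
    its length, hence is [leb] by uniqueness. *)
Lemma lebesgue_measure_scale r (A : set (measurableTypeR R)) :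
  0 < r -> measurable A ->
  leb ( *%R r @^-1` A) = (r^-1%:E * leb A)%E.
Proof.
move=> r0 mA.
have mr : measurable_fun [set: measurableTypeR R] ( *%R r : _ -> measurableTypeR R).
  exact: mulrl_measurable.
pose m' : {measure set (measurableTypeR R) -> \bar R} :=
  mscale (NngNum (ltW r0)) (pushforward_measure leb mr).
suff -> : leb A = m' A.
  rewrite /m' /= /mscale /= muleA -EFinM mulVf ?gt_eqF//.
  by rewrite mul1e.
apply: lebesgue_measure_unique => // _ [[a b]] _ <-.
rewrite /m' /= /mscale /= /pushforward.
rewrite (_ : _ @^-1` _ = [set` `]a / r, b / r]]); last first.
  apply/seteqP; split => x /=; rewrite !in_itv /=.
    by rewrite ltr_pdivrMr// ler_pdivlMr// ![x * r]mulrC.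
  by rewrite ltr_pdivrMr// ler_pdivlMr// ![x * r]mulrC.
rewrite !lebesgue_measure_itv/= !lte_fin ltr_pM2r ?invr_gt0//.
case: ifPn => _; last by rewrite mule0.
by rewrite -EFinB -EFinM -mulrBl mulrCA divff ?mulr1// gt_eqF.
Qed.

(** Induction on the dimension: on rectangles the factor splits as r times r^d, and uniqueness of
    the product measure does the rest. *)
Lemma lebesgue_scale d r (A : set (euclid R d)) :
  0 < r -> measurable A ->
  lebesgue R d (scale_tuple r @^-1` A) = ((r^-1 ^+ d)%:E * lebesgue R d A)%E.
Proof.
move=> r0; elim: d A => [|d IH] A mA.
  rewrite expr0 mul1e; congr (lebesgue R 0 _).
  by apply/seteqP; split => x; rewrite /= [scale_tuple r x]tuple0 [x]tuple0.
pose S (p : measurableTypeR R * euclid R d) : measurableTypeR R * euclid R d :=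
  (r * p.1, scale_tuple r p.2).
have mS : measurable_fun setT S.
  apply/measurable_fun_pairP; split.
    apply: measurable_funM; [exact: measurable_cst|exact: measurable_fst].
  exact: (measurableT_comp (@measurable_scale_tuple d r) measurable_snd).
have r'0 : 0 <= r ^+ d.+1 by rewrite exprn_ge0// ltW.
pose m' : {measure set (measurableTypeR R * euclid R d) -> \bar R} :=
  mscale (NngNum r'0) (pushforward_measure (leb \x lebesgue R d)%E mS).
have mpre : measurable (@tuple_cons R d @^-1` A).
  by rewrite -[X in measurable X]setTI; exact: measurable_tuple_cons.
rewrite /= /lebesgue_cons /pushforward.
rewrite (_ : _ @^-1` _ = S @^-1` (@tuple_cons R d @^-1` A)); last first.
  have e p : scale_tuple r (tuple_cons p) = tuple_cons (S p).
    apply: eq_from_tnth => i; rewrite tnth_mktuple.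
    by case: (unliftP ord0 i) => [j|] ->; rewrite ?tnthS ?tnth0//= tnth_mktuple.
  by apply/seteqP; split => p /=; rewrite /preimage/= e.
have E : forall X, measurable X -> (leb \x lebesgue R d)%E X = m' X.
  apply: product_measure_unique => A1 A2 mA1 mA2.
  rewrite /m' /= /mscale /= /pushforward.
  rewrite (_ : _ @^-1` _ = ( *%R r @^-1` A1) `*` (scale_tuple r @^-1` A2)).
    rewrite product_measure1E//=; last 2 first.
      by rewrite -[X in measurable X]setTI; exact: mulrl_measurable.
      by rewrite -[X in measurable X]setTI; exact: measurable_scale_tuple.
    rewrite lebesgue_measure_scale// IH// [X in (_ * X)%E]muleACA -EFinM -exprS.
    by rewrite [LHS]muleA -EFinM -exprMn divff ?gt_eqF// expr1n mul1e.
  by apply/seteqP; split => -[].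
rewrite [in RHS]E// /m' /= /mscale /= muleA -EFinM -exprMn mulVf ?gt_eqF//.
by rewrite expr1n mul1e.
Qed.

End scaling.

(** * Polar coordinates on the ball *)

Section polar.
Variable R : realType.
Local Notation leb := (@lebesgue_measure R).

Lemma enorm_ge0 d (x : euclid R d) : 0 <= enorm x.
Proof. exact: sqrtr_ge0. Qed.

Lemma sqr_enorm d (x : euclid R d) : enorm x ^+ 2 = \sum_i (tnth x i : R) ^+ 2.
Proof. by rewrite sqr_sqrtr// sumr_ge0// => i _; exact: sqr_ge0. Qed.

Lemma enorm_scale d (r : R) (x : euclid R d) :
  0 <= r -> enorm (scale_tuple r x) = r * enorm x.
Proof.
move=> r0; rewrite /enorm.
under eq_bigr do rewrite tnth_mktuple exprMn.
by rewrite -mulr_sumr sqrtrM ?sqr_ge0// sqrtr_sqr ger0_norm.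
Qed.

Lemma direction_scale d (r : R) (x : euclid R d) :
  0 < r -> direction (scale_tuple r x) = direction x.
Proof.
move=> r0; apply: eq_from_tnth => i; rewrite !tnth_mktuple (enorm_scale _ (ltW r0)).
by rewrite invfM mulrACA mulVf ?gt_eqF// mul1r.
Qed.

Lemma tnth_enorm0 d (x : euclid R d) i : enorm x = 0 -> tnth x i = 0 :> R.
Proof.
move=> x0; have : enorm x ^+ 2 = 0 by rewrite x0 expr0n.
rewrite sqr_enorm => /eqP; rewrite psumr_eq0; last by move=> j _; exact: sqr_ge0.
by move=> /allP/(_ i (mem_index_enum _)); rewrite sqrf_eq0 => /eqP.
Qed.

Lemma scale_direction d (x : euclid R d) : scale_tuple (enorm x) (direction x) = x.
Proof.
apply: eq_from_tnth => i; rewrite !tnth_mktuple mulrA.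
have [x0|x0] := eqVneq (enorm x) 0; last by rewrite divff// mul1r.
by rewrite x0 !mul0r [RHS]tnth_enorm0.
Qed.

Lemma enorm_direction d (x : euclid R d) : enorm x != 0 -> enorm (direction x) = 1.
Proof.
move=> x0; rewrite (_ : direction x = scale_tuple (enorm x)^-1 x)//.
by rewrite enorm_scale ?invr_ge0 ?enorm_ge0// mulVf.
Qed.

Lemma normr_tnth_le_enorm d (x : euclid R d) i : `|tnth x i : R| <= enorm x.
Proof.
rewrite -sqrtr_sqr ler_wsqrtr// (bigD1 i)//= lerDl sumr_ge0// => j _.
exact: sqr_ge0.
Qed.

Lemma enorm_cons d (t : R) (x : euclid R d) :
  enorm (tuple_cons (t, x)) ^+ 2 = t ^+ 2 + enorm x ^+ 2.
Proof.
rewrite !sqr_enorm big_ord_recl; congr (_ + _).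
by apply: eq_bigr => i _; rewrite tnthS.
Qed.

(** The ball lies in the product of [-1, 1] and the ball of one dimension less. *)
Lemma lebesgue_unit_ball_lty d : (lebesgue R d (@unit_ball R d) < +oo)%E.
Proof.
elim: d => [|d IH].
  by rewrite /= diracE; case: (_ \in _); rewrite ?ltry.
rewrite /= /lebesgue_cons /pushforward.
apply: (@le_lt_trans _ _ ((leb \x lebesgue R d)%E (`[-1, 1] `*` @unit_ball R d))).
  apply: le_measure; rewrite ?inE.
  - rewrite -[X in measurable X]setTI; apply: measurable_tuple_cons => //.
    exact: measurable_unit_ball.
  - by apply: measurableX => //; exact: measurable_unit_ball.
  - move=> -[t x] /= h; split => /=.
      rewrite in_itv/= -ler_norml; apply: le_trans h.
      by have := normr_tnth_le_enorm (tuple_cons (t, x)) ord0; rewrite tnth0.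
    apply: le_trans h; rewrite -[leLHS]ger0_norm ?enorm_ge0//.
    rewrite -sqrtr_sqr -[leRHS]ger0_norm ?enorm_ge0// -[leRHS]sqrtr_sqr.
    by rewrite ler_wsqrtr// enorm_cons lerDr sqr_ge0.
rewrite product_measure1E//=; last exact: measurable_unit_ball.
rewrite lte_mul_pinfty// lebesgue_measure_itv/=.
by case: ifP => // _; rewrite -EFinB.
Qed.

Definition radial_coord d (x : euclid R d) : measurableTypeR R := 2 * enorm x ^+ 2 - 1.

Lemma measurable_radial_coord d : measurable_fun [set: euclid R d] (@radial_coord d).
Proof.
apply: measurable_funB; last exact: measurable_cst.
apply: measurable_funM; first exact: measurable_cst.
by apply: measurable_funX; exact: measurable_enorm.
Qed.

Lemma measurable_direction_pre d (A : set (euclid R d)) : measurable A ->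
  measurable (@direction R d @^-1` A).
Proof.
by move=> mA; rewrite -[X in measurable X]setTI; exact: measurable_direction.
Qed.

Lemma unit_ball_scale d (r : R) (x : euclid R d) : 0 < r ->
  unit_ball (scale_tuple r^-1 x) <-> enorm x <= r.
Proof.
move=> r0; rewrite /unit_ball/= enorm_scale; last by rewrite invr_ge0 ltW.
by rewrite mulrC ler_pdivrMr// mul1r.
Qed.

(** Directions are invariant under dilation, so this cone is a dilate of the cone of radius 1. *)
Lemma lebesgue_cone d (r : R) (A : set (euclid R d)) : 0 < r -> measurable A ->
  (lebesgue R d ([set x | enorm x <= r]%R `&` @direction R d @^-1` A) =
   (r ^+ d)%:E * lebesgue R d (@unit_ball R d `&` @direction R d @^-1` A))%E.
Proof.
move=> r0 mA; have r'0 : 0 < r^-1 by rewrite invr_gt0.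
rewrite -[in RHS](invrK r) -lebesgue_scale//; last first.
  apply: measurableI; first exact: measurable_unit_ball.
  exact: measurable_direction_pre.
congr (lebesgue R d _); apply/seteqP; split => x /=; rewrite direction_scale//.
  by case=> xr Ax; split => //; exact/unit_ball_scale.
by case=> /unit_ball_scale-/(_ r0).
Qed.

(** The set is invariant under dilation by 2, so its measure u, which is finite, satisfies u =
    2^(-d) u. *)
Lemma lebesgue_enorm0 d : (0 < d)%N ->
  lebesgue R d [set x | enorm x = 0] = 0%E.
Proof.
move=> d0; set N := [set x | _].
have mN : measurable N.
  rewrite (_ : N = @enorm R d @^-1` [set 0])//.
  by rewrite -[X in measurable X]setTI; exact: measurable_enorm.
have Noo : (lebesgue R d N < +oo)%E.
  apply: le_lt_trans (lebesgue_unit_ball_lty d).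
  apply: le_measure; rewrite ?inE//; first exact: measurable_unit_ball.
  by move=> x; rewrite /N/unit_ball/= => ->.
have := @lebesgue_scale R d 2 N (ltr0Sn _ 1) mN.
rewrite (_ : _ @^-1` _ = N); last first.
  apply/seteqP; split => x; rewrite /N/= enorm_scale//; last by move=> ->; rewrite mulr0.
  by move/eqP; rewrite mulf_eq0 pnatr_eq0/= => /eqP.
have : lebesgue R d N \is a fin_num by rewrite ge0_fin_numE.
case: (lebesgue R d N) => // u _ [] /eqP.
rewrite -subr_eq0 -{1}[u]mul1r -mulrBl mulf_eq0 subr_eq0 => /orP[|/eqP->//].
rewrite eq_sym lt_eqF// exprn_ilt1 -?lt0n ?invr_ge0//.
by rewrite invf_lt1// ltr1n.
Qed.

(** Only x = 0 has a direction off the sphere, and the origin is a null set. Integrals over the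
    sphere may therefore be taken over the whole space. *)
Lemma surface_measure_setC_sphere d : (0 < d)%N ->
  @surface_measure R d (~` @unit_sphere R d) = 0%E.
Proof.
move=> d0; rewrite /surface_measure; apply/eqP; rewrite mule_eq0; apply/orP; right.
have mS : measurable (@unit_sphere R d).
  rewrite (_ : @unit_sphere R d = @enorm R d @^-1` [set 1])//.
  by rewrite -[X in measurable X]setTI; exact: measurable_enorm.
rewrite eq_le measure_ge0 andbT -(lebesgue_enorm0 d0).
apply: le_measure; rewrite ?inE.
- apply: measurableI; first exact: measurable_unit_ball.
  by apply: measurable_direction_pre; exact: measurableC.
- rewrite (_ : [set x | _] = @enorm R d @^-1` [set 0])//.
  by rewrite -[X in measurable X]setTI; exact: measurable_enorm.
- move=> x [_] /= nS; apply: contrapT => /eqP x0; apply: nS.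
  exact: enorm_direction.
Qed.

Lemma measurable_unit_sphere d : measurable (@unit_sphere R d).
Proof.
rewrite (_ : @unit_sphere R d = @enorm R d @^-1` [set 1])//.
by rewrite -[X in measurable X]setTI; exact: measurable_enorm.
Qed.

Lemma surface_measure_fin d : fin_num_fun (@surface_measure R d).
Proof.
move=> A mA; rewrite ge0_fin_numE// /surface_measure lte_mul_pinfty//.
apply: le_lt_trans (lebesgue_unit_ball_lty d).
apply: le_measure; rewrite ?inE//.
- by apply: measurableI; [exact: measurable_unit_ball|exact: measurable_direction_pre].
- exact: measurable_unit_ball.
Qed.

End polar.

(** * Measures with a density, and uniqueness of measures on the line *)

Section density.
Context d (T : measurableType d) (R : realType).
Variables (m : {sigma_finite_measure set T -> \bar R}) (w : T -> R).
Hypotheses (mw : measurable_fun setT w) (w0 : forall x, 0 <= w x).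

Definition density_measure (w' : T -> R) (A : set T) : \bar R :=
  (\int[m]_(x in A) (w' x)%:E)%E.

Let density0 : density_measure w set0 = 0%E.
Proof. by rewrite /density_measure integral_set0. Qed.

Let density_ge0 A : (0 <= density_measure w A)%E.
Proof. by apply: integral_ge0 => x _; rewrite lee_fin. Qed.

Let density_sigma_additive : semi_sigma_additive (density_measure w).
Proof.
move=> F mF tF mUF; rewrite /density_measure; apply: cvg_toP.
  apply: ereal_nondecreasing_is_cvgn => a b ab.
  apply: lee_sum_nneg_natr => // k _ _; exact: density_ge0.
rewrite ge0_integral_bigcup//=.
- by apply/measurable_funTS/measurable_EFinP.
- by move=> x _; rewrite lee_fin.
Qed.

Definition density_of : {measure set T -> \bar R} :=
  HB.pack_for {measure set T -> \bar R} (density_measure w)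
    (isMeasure.Build _ _ _ (density_measure w)
       density0 density_ge0 density_sigma_additive).

(** The formula is known for the Radon-Nikodym derivative of [nu], which equals [w] almost
    everywhere because both have the same integral over every measurable set. *)
Lemma ge0_integral_density (nu : {finite_measure set T -> \bar R})
    (f : T -> \bar R) E :
  (forall A, measurable A -> nu A = density_measure w A) ->
  measurable E -> (forall x, 0 <= f x)%E -> measurable_fun E f ->
  (\int[nu]_(x in E) f x = \int[m]_(x in E) (f x * (w x)%:E))%E.
Proof.
move=> nuE mE f0 mf.
have mwE : measurable_fun setT (EFin \o w) by exact/measurable_EFinP.
have numu : nu `<< m.
  apply/null_content_dominatesP => A mA mA0; rewrite nuE//.
  by rewrite /density_measure null_set_integral//; exact: measurable_funTS.
rewrite -(Radon_Nikodym_SigmaFinite.change_of_variables numu)//.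
have fm : measurable_fun setT (Radon_Nikodym_SigmaFinite.f nu m).
  exact: measurable_int (Radon_Nikodym_SigmaFinite.f_integrable numu).
apply: ae_eq_integral => //.
- by apply: emeasurable_funM => //; exact: measurable_funTS.
- by apply: emeasurable_funM => //; exact: measurable_funTS.
apply: ae_eqe_mul2l; apply: ae_eq_subset (@subsetT _ E) _.
apply: integral_ae_eq => //.
- exact: Radon_Nikodym_SigmaFinite.f_integrable.
- move=> A _ mA; rewrite -Radon_Nikodym_SigmaFinite.f_integral// nuE//.
Qed.

End density.

Section uniqueness.
Variable R : realType.

(** Rays suffice: ]a, b] is a difference of two rays of finite measure, and these intervals are
    stable under intersection and generate the measurable sets. *)
Lemma measure_eq_itvNyc (m1 m2 : {measure set (measurableTypeR R) -> \bar R}) :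
  (forall t : R, m1 [set` `]-oo, t]] = m2 [set` `]-oo, t]]) ->
  (forall t : R, m1 [set` `]-oo, t]] < +oo)%E ->
  forall A, measurable A -> m1 A = m2 A.
Proof.
move=> m12 m1oo.
have oc a b : [set` `]a, b]] = [set` `]-oo, b]] `\` [set` `]-oo, a]] :> set R.
  apply/seteqP; split => x /=; rewrite !in_itv/=.
    by move=> /andP[ax xb]; split => //; rewrite leNgt ax.
  by case=> -> /negP; rewrite -ltNge => ->.
have fin (t : R) : m1 [set` `]-oo, t]] \is a fin_num by rewrite ge0_fin_numE.
apply: (@measure_unique _ R (measurableTypeR R) (@ocitv R)
  (fun k : nat => [set` `]((- k%:R) : R), k%:R]])) => //.
- exact: ocitvI.
- by move=> k; exists (- k%:R, k%:R).
- apply/seteqP; split => // x _.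
  exists (Num.truncn `|x|).+1 => //=; rewrite in_itv/=.
  have h : `|x| < (Num.truncn `|x|).+1%:R by exact: truncnS_gt.
  by move: h; rewrite ltr_norml => /andP[-> /ltW].
- move=> _ [[a b]] _ <- /=; rewrite oc !measureD//= -?m12//.
  have [ab|ba] := leP a b.
    rewrite setIidr ?m12// => x /=; rewrite !in_itv/= => xa; exact: le_trans ab.
  by rewrite setIidl ?m12// => x /=; rewrite !in_itv/= => /le_trans->//; exact: ltW.
- move=> k; rewrite oc; apply: le_lt_trans (m1oo k%:R).
  by apply: le_measure; rewrite ?inE//=; exact: measurableD.
Qed.

End uniqueness.

(** * Integrals of powers of 1 + t and 1 - t *)

Section powR_integrals.
Variable R : realType.
Local Notation leb := (@lebesgue_measure R).
Implicit Types a b c e s t : R.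

(** The slope [e] is a parameter in order to serve both 1 + s and 1 - s; this is why [1 * s] and
    [-1 * s] appear below. *)
Lemma is_derive1_powR_affine a e c s : 0 < a + e * s ->
  is_derive s 1 (fun s => (a + e * s) `^ c) (c * (a + e * s) `^ (c - 1) * e).
Proof.
move=> h.
have h1 : is_derive s (1:R) (fun s => a + e * s) e.
  by apply: is_derive_eq; rewrite /GRing.scale/=; ring.
exact: (@is_derive1_comp R (@powR R ^~ c) (fun s => a + e * s) s _ _
  (is_derive1_powR c h) h1).
Qed.

Lemma continuous_powR_affine a e c s : 0 < a + e * s ->
  {for s, continuous (fun s => (a + e * s) `^ c)}.
Proof.
move=> h; apply: differentiable_continuous; apply/derivable1_diffP.
by have [] := is_derive1_powR_affine c h.
Qed.

Lemma within_continuous_powR1D c t : 0 <= c -> -1 < t ->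
  {within `[-1, t], continuous (fun s => (1 + 1 * s) `^ c)}.
Proof.
move=> c0 t1; apply/continuous_within_itvP => //; split.
- move=> s; rewrite in_itv/= => /andP[s1 _]; apply: continuous_powR_affine.
  by rewrite mul1r -ltrBlDl sub0r.
(* At the endpoint -1 the base is 0. For [c = 0] the function is constantly 1, also there; for
   [c > 0] its value and its limit are 0. *)
- move: c0; rewrite le_eqVlt => /predU1P[<-|c0].
    by under eq_fun do rewrite powRr0; rewrite powRr0; exact: cvg_cst.
  rewrite mul1r subrr powR0 ?gt_eqF//.
  apply: (@cvg_comp _ _ _ (fun s : R => 1 + 1 * s) (@powR R ^~ c) _ 0^'+);
    last exact: powR_cvg0.
  move=> P [e /= e0 eP]; exists e => //= s /= se s1; apply: eP => /=.
    by move: se; rewrite /ball_ (_ : 0 - _ = -1 - s)//; ring.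
  by rewrite mul1r -ltrBlDl sub0r.
- apply: cvg_at_left_filter; apply: continuous_powR_affine.
  by rewrite mul1r -ltrBlDl sub0r.
Qed.

Lemma integral_powR1D b t : 0 <= b -> -1 <= t ->
  (\int[leb]_(s in `[(-1)%R, t]) ((1 + s) `^ b)%R%:E =
   ((1 + t) `^ (b + 1) / (b + 1))%R%:E)%E.
Proof.
move=> b0; have b1 : 0 < b + 1 by rewrite ltr_wpDl.
rewrite le_eqVlt => /predU1P[<-|t1].
  rewrite set_itv1 integral_set1 subrr powR0 ?mul0r//.
  by rewrite gt_eqF.
under eq_integral do rewrite -[X in (1 + X)%R]mul1r.
have c1 := within_continuous_powR1D (ltW b1) t1.
rewrite (@continuous_FTC2 _ _ (fun s => (b + 1)^-1 * (1 + 1 * s) `^ (b + 1)))//.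
- rewrite !mul1r subrr powR0 ?gt_eqF// mulr0 sube0 mulrC//.
- exact: within_continuous_powR1D.
- have /continuous_within_itvP-/(_ t1)[_ cl cr] := c1.
  split.
  + move=> s; rewrite in_itv/= => /andP[s1 _]; apply: derivableM => //.
    have h : 0 < 1 + 1 * s by rewrite mul1r -ltrBlDl sub0r.
    by have [] := is_derive1_powR_affine (b + 1) h.
  + by apply: cvgM => //; exact: cvg_cst.
  + by apply: cvgM => //; exact: cvg_cst.
- move=> s; rewrite in_itv/= => /andP[s1 _].
  have h : 0 < 1 + 1 * s by rewrite mul1r -ltrBlDl sub0r.
  rewrite derive1E; apply: derive_val.
  have h1 := is_derive1_powR_affine (b + 1) h.
  apply: is_derive_eq.
  by rewrite /GRing.scale/= addrK; field; rewrite gt_eqF.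
Qed.

(** For [c < 0] the integrand is unbounded at 1, so [-1, 1[ is exhausted by the intervals
    [-1, 1 - 1/(n+1)]. On each of them the fundamental theorem applies, and minus the value of the
    primitive at -1, that is 2^(c+1)/(c+1), bounds all the integrals. *)
Lemma integrable_powR1B c : -1 < c ->
  leb.-integrable `[-1, 1] (fun s => ((1 - s) `^ c)%:E).
Proof.
move=> c1; have c1' : 0 < c + 1 by rewrite -ltrBlDr sub0r.
have m : measurable_fun setT (fun s : R => (1 - s) `^ c).
  apply: (@measurableT_comp _ _ _ _ _ _ (@powR R ^~ c)).
    exact: measurable_powR.
  by apply: measurable_funB => //; exact: measurable_cst.
apply/integrableP; split.
  by apply/measurable_EFinP; exact: measurable_funTS.
under eq_integral do rewrite gee0_abs ?lee_fin ?powR_ge0//.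
rewrite -integral_itv_bndo_bndc; last exact/measurable_EFinP/measurable_funTS.
pose F (n : nat) : set (measurableTypeR R) := [set` `[-1, 1 - n.+1%:R^-1]].
have UF : \bigcup_n F n = [set` `[-1, 1[].
  apply/seteqP; split => x /=.
    move=> [n _]; rewrite /F /= !in_itv/= => /andP[-> /le_lt_trans]; apply.
    by rewrite ltrBlDr ltrDl invr_gt0.
  rewrite in_itv/= => /andP[x1 x2]; exists (Num.truncn (1 - x)^-1) => //.
  rewrite /F /= in_itv/= x1/= lerBrDr -lerBrDl -[leRHS]invrK.
  rewrite lef_pV2 ?posrE ?invr_gt0 ?subr_gt0// ltW// truncnS_gt//.
have Fnd : nondecreasing_seq F.
  apply/nondecreasing_seqP => n; apply/subsetPset => x.
  rewrite /F /= !in_itv/= => /andP[-> /le_trans]; apply.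
  by rewrite lerD2l lerN2 lef_pV2 ?posrE// ler_nat.
have := @ge0_nondecreasing_set_cvg_integral _ (measurableTypeR R) R F
  (fun s => ((1 - s) `^ c)%:E) leb.
have mF i : measurable (F i) by exact: measurable_itv.
have mf i : measurable_fun (F i) (fun s => ((1 - s) `^ c)%:E).
  exact/measurable_EFinP/measurable_funTS.
move=> /(_ Fnd mF mf); rewrite UF => cv.
have {}cv := cv (fun _ s _ => powR_ge0 (1 - s) c : (0 <= (_ `^ _)%:E)%E).
rewrite -(cvg_lim _ cv)//.
apply: (@le_lt_trans _ _ (2 `^ (c + 1) / (c + 1))%:E); last exact: ltry.
apply: lime_le; first by apply/cvg_ex; eexists; exact: cv.
apply: nearW => n.
have n1 : -1 < 1 - n.+1%:R^-1 :> R.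
  rewrite ltrBrDl -ltrBrDr (_ : 1 - -1 = 2); last by ring.
  by rewrite (@le_lt_trans _ _ 1) ?ltr1n// invf_le1// ler1n.
have pos s : s <= 1 - n.+1%:R^-1 -> 0 < 1 + (-1) * s.
  move=> h; rewrite mulN1r subr_gt0; apply: le_lt_trans h _.
  by rewrite ltrBlDr ltrDl invr_gt0.
rewrite /F; under eq_integral do rewrite -[X in (1 + X)%R]mulN1r.
rewrite (@continuous_FTC2 _ _ (fun s => - (c + 1)^-1 * (1 + -1 * s) `^ (c + 1)))//.
- rewrite -EFinB lee_fin (_ : 1 + -1 * -1 = 2); last by ring.
  rewrite !mulNr opprK addrC mulrC gerBl mulr_ge0 ?powR_ge0// invr_ge0.
  exact: ltW.
- apply: continuous_in_subspaceT => s; rewrite inE/= in_itv/= => /andP[_ s1].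
  by apply: continuous_powR_affine; exact: pos.
- have cF s : s <= 1 - n.+1%:R^-1 ->
      {for s, continuous (fun s => - (c + 1)^-1 * (1 + -1 * s) `^ (c + 1))}.
    move=> h; apply: cvgM; first exact: cvg_cst.
    by apply: continuous_powR_affine; exact: pos.
  split.
  + move=> s; rewrite in_itv/= => /andP[_ /ltW s1]; apply: derivableM => //.
    by have [] := is_derive1_powR_affine (c + 1) (pos _ s1).
  + by apply: cvg_at_right_filter; apply: cF; exact: ltW.
  + by apply: cvg_at_left_filter; exact: cF.
- move=> s; rewrite in_itv/= => /andP[_ /ltW s1].
  rewrite derive1E; apply: derive_val.
  have h1 := is_derive1_powR_affine (c + 1) (pos _ s1).
  apply: is_derive_eq.
  by rewrite /GRing.scale/= addrK; field; rewrite gt_eqF.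
Qed.

End powR_integrals.

(** * Integration of signed functions against a density *)

Section density_integrable.
Context d (T : measurableType d) (R : realType).
Variables (m : {sigma_finite_measure set T -> \bar R}) (w : T -> R).
Hypotheses (mw : measurable_fun setT w) (w0 : forall x, 0 <= w x).
Variable nu : {finite_measure set T -> \bar R}.
Hypothesis nuE : forall A, measurable A -> nu A = density_measure m w A.
Variables (f : T -> R) (E : set T).
Hypotheses (mE : measurable E) (mf : measurable_fun E f).
Hypothesis intf : m.-integrable E (fun x => (f x * w x)%:E).

Lemma integrable_density : nu.-integrable E (EFin \o f).
Proof.
apply/integrableP; split; first exact/measurable_EFinP.
have ma : measurable_fun E (fun x => `|(EFin \o f) x|)%E.
  by apply: measurableT_comp => //; exact/measurable_EFinP.
rewrite (ge0_integral_density mw nuE mE (fun x => abse_ge0 _) ma).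
move/integrableP : intf => [_]; congr (_ < +oo)%E; apply: eq_integral => x _.
by rewrite -EFinM /= normrM (ger0_norm (w0 x)).
Qed.

Lemma integral_density :
  (\int[nu]_(x in E) (f x)%:E = \int[m]_(x in E) (f x * w x)%:E)%E.
Proof.
have me : measurable_fun E (EFin \o f) by exact/measurable_EFinP.
rewrite integralE [RHS]integralE.
rewrite (ge0_integral_density mw nuE mE (fun x => funepos_ge0 _ x) (measurable_funepos me)).
rewrite (ge0_integral_density mw nuE mE (fun x => funeneg_ge0 _ x) (measurable_funeneg me)).
congr (_ - _)%E; apply: eq_integral => x _.
  by rewrite !funeposE /= -!EFin_max -EFinM maxr_pMl// mul0r.
by rewrite !funenegE /= -!EFin_max -EFinM maxr_pMl// mul0r mulNr.
Qed.

End density_integrable.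

Lemma powR_divr2 (R : realType) (x y : R) : 0 <= x ->
  (x / 2) `^ y = x `^ y / 2 `^ y.
Proof.
move=> x0; rewrite powRM ?invr_ge0//; congr (_ * _).
by rewrite -[X in X `^ y]powR_inv1// -powRrM mulN1r powRN.
Qed.

(** * The radial part of Lebesgue measure *)

Section radial_measure.
Variables (R : realType) (d : nat).
Local Notation leb := (@lebesgue_measure R).

(** This is r^(d-1) dr in the variable t = 2 r^2 - 1: since dt = 4 r dr, it equals
    ((1+t)/2)^((d-2)/2) dt/4. *)
Definition radial_density (t : measurableTypeR R) : R :=
  ((fun s : R => (2 `^ (d%:R / 2 + 1))^-1 * (1 + s) `^ ((d%:R - 2) / 2))
    \_ `[-1, 1]) t.

Lemma radial_density_ge0 t : 0 <= radial_density t.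
Proof.
rewrite /radial_density patchE; case: ifP => // _.
by rewrite mulr_ge0 ?invr_ge0 ?powR_ge0.
Qed.

Lemma measurable_radial_density : measurable_fun setT radial_density.
Proof.
apply/(measurable_restrictT _ (measurable_itv _)).
apply: measurable_funM; first exact: measurable_cst.
apply: measurable_funTS.
apply: (@measurableT_comp _ _ _ _ _ _ (@powR R ^~ _)).
  exact: measurable_powR.
by apply: measurable_funD => //; exact: measurable_cst.
Qed.

Definition radial_measure : {measure set (measurableTypeR R) -> \bar R} :=
  density_of leb measurable_radial_density radial_density_ge0.

(** The value is r^d/d for the radius r with r^2 = (1 + min(t, 1))/2; the factor 1/d cancels the
    factor d in [surface_measure]. *)
Lemma radial_measure_itv (t : R) : (2 <= d)%N ->
  radial_measure [set` `]-oo, t]] =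
  (if t < -1 then 0 else
   d%:R^-1 * ((1 + Num.min t 1) / 2) `^ (d%:R / 2))%:E.
Proof.
move=> d2; rewrite /radial_measure/= /density_measure.
rewrite (_ : (fun s => (radial_density s)%:E) = (EFin \o (fun s : R =>
  (2 `^ (d%:R / 2 + 1))^-1 * (1 + s) `^ ((d%:R - 2) / 2))) \_ `[-1, 1]);
  last by rewrite restrict_EFin.
rewrite -integral_mkcondr.
have -> : [set` `]-oo, t]] `&` [set` `[-1, 1]] = [set` `[-1, Num.min t 1]] :> set R.
  apply/seteqP; split => x /=; rewrite !in_itv/= le_min.
    by case=> -> /andP[-> ->].
  by move=> /andP[-> /andP[-> ->]].
case: ltP => t1.
  rewrite set_itv_ge ?integral_set0// bnd_simp -ltNge gt_min t1//.
have t1' : -1 <= Num.min t 1 by rewrite le_min t1/= (@le_trans _ _ 0).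
under eq_integral do rewrite /= EFinM.
have dn0 : d%:R != 0 :> R by rewrite pnatr_eq0 -lt0n (leq_trans _ d2).
have b0 : 0 <= (d%:R - 2) / 2 :> R by rewrite divr_ge0// subr_ge0 ler_nat.
rewrite ge0_integralZl//=; last 2 first.
- apply/measurable_EFinP/measurable_funTS.
  apply: (@measurableT_comp _ _ _ _ _ _ (@powR R ^~ _)).
    exact: measurable_powR.
  by apply: measurable_funD => //; exact: measurable_cst.
- by move=> x _; rewrite lee_fin powR_ge0.
rewrite integral_powR1D// -EFinM; congr EFin.
rewrite (_ : (d%:R - 2) / 2 + 1 = d%:R / 2); last by field.
rewrite powR_divr2; last by rewrite -lerBlDl sub0r.
rewrite powRD ?pnatr_eq0 ?implybT// powRr1//; field.
by rewrite dn0 gt_eqF ?powR_gt0.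
Qed.

Lemma radial_measure_fin : (2 <= d)%N -> fin_num_fun radial_measure.
Proof.
move=> d2 A mA; rewrite ge0_fin_numE//.
apply: (@le_lt_trans _ _ (radial_measure setT)).
  by apply: le_measure; rewrite ?inE.
rewrite [ltLHS](_ : _ = radial_measure [set` `]-oo, 1]]); last first.
  rewrite /radial_measure/= /density_measure.
  rewrite [RHS]integral_mkcond; apply: eq_integral => x _; rewrite patchE.
  case: ifPn => //; rewrite notin_setE /= in_itv/= => /negP; rewrite -ltNge => x1.
  rewrite /radial_density patchE ifN//; apply/negP; rewrite inE/= in_itv/=.
  by rewrite [_ <= 1]leNgt x1 andbF.
by rewrite radial_measure_itv// ltry.
Qed.

End radial_measure.

Section polar_measure.
Variables (R : realType) (d : nat).
Hypothesis d2 : (2 <= d)%N.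
Local Notation leb := (@lebesgue_measure R).

Let d0 : (0 < d)%N. Proof. exact: leq_trans d2. Qed.

Lemma lebesgue_radial_coord_le (A : set (euclid R d)) (t : R) :
  -1 <= t <= 1 -> measurable A ->
  (lebesgue R d ((@radial_coord R d) @^-1` [set` `]-oo, t]] `&`
     (@unit_ball R d `&` @direction R d @^-1` A)) =
   (((1 + t) / 2) `^ (d%:R / 2))%:E *
     lebesgue R d (@unit_ball R d `&` @direction R d @^-1` A))%E.
Proof.
move=> /andP[t1 t2] mA; have mpA := measurable_direction_pre mA.
have mball := @measurable_unit_ball R d.
have dR : d%:R != 0 :> R by rewrite pnatr_eq0 -lt0n.
have s0 : 0 <= (1 + t) / 2 by rewrite divr_ge0// -lerBlDl sub0r.
(* At t = -1 the cone shrinks to the origin, a case outside [lebesgue_cone], which asks for a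
   positive radius. *)
have [s00|s01] := eqVneq ((1 + t) / 2) 0.
  rewrite s00 powR0 ?mulf_neq0 ?invr_eq0// mul0e.
  apply/eqP; rewrite eq_le measure_ge0 andbT -(lebesgue_enorm0 R d0).
  apply: le_measure; rewrite ?inE.
  - apply: measurableI; last exact: measurableI.
    by rewrite -[X in measurable X]setTI; apply: measurable_radial_coord.
  - rewrite (_ : [set x | _] = @enorm R d @^-1` [set 0])//.
    by rewrite -[X in measurable X]setTI; exact: measurable_enorm.
  - move=> x [] /=; rewrite in_itv/= /radial_coord => xt _.
    have {}xt : enorm x ^+ 2 <= 0 by rewrite -s00; lra.
    by apply/eqP; rewrite -sqrf_eq0 eq_le xt sqr_ge0.
have sp : 0 < (1 + t) / 2 by rewrite lt_neqAle eq_sym s01.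
have r0 : 0 < Num.sqrt ((1 + t) / 2) by rewrite sqrtr_gt0.
have <- : Num.sqrt ((1 + t) / 2) ^+ d = ((1 + t) / 2) `^ (d%:R / 2).
  by rewrite -powR12_sqrt// -powR_mulrn ?powR_ge0// -powRrM [2^-1 * _]mulrC.
rewrite -lebesgue_cone//; congr (lebesgue R d _).
have rE (x : euclid R d) : (enorm x <= Num.sqrt ((1 + t) / 2)) = (radial_coord x <= t :> R).
  rewrite -ler_sqr ?nnegrE ?sqrtr_ge0 ?enorm_ge0// [Num.sqrt ((1 + t) / 2) ^+ 2]sqr_sqrtr//.
  by rewrite /radial_coord; apply/idP/idP => h; lra.
apply/seteqP; split => x /=.
  by rewrite in_itv/= => -[xt [_ Ax]]; split => //=; rewrite rE.
rewrite rE in_itv/= => -[xt Ax]; split => //; split => //.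
rewrite /unit_ball /= -(@ler_sqr _ (enorm x))// ?nnegrE ?enorm_ge0//.
by rewrite expr1n; move: xt; rewrite /radial_coord; lra.
Qed.

(** For fixed [A] both sides are measures in [B], so it is enough to compare them on rays. *)
Lemma lebesgue_radial_coord_direction (A : set (euclid R d))
    (B : set (measurableTypeR R)) : measurable A -> measurable B ->
  (lebesgue R d ((@radial_coord R d) @^-1` B `&`
     (@unit_ball R d `&` @direction R d @^-1` A)) =
   surface_measure A * radial_measure R d B)%E.
Proof.
move=> mA; have mpA := measurable_direction_pre mA.
have mball := @measurable_unit_ball R d.
have mbA := measurableI _ _ mball mpA.
have dR : d%:R != 0 :> R by rewrite pnatr_eq0 -lt0n.
have sfin : surface_measure A \is a fin_num by exact: surface_measure_fin.
have s0 : 0 <= fine (surface_measure A) by rewrite fine_ge0.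
pose m1 := pushforward_measure (mrestr (lebesgue R d) mbA) (@measurable_radial_coord R d).
pose m2 := mscale (NngNum s0) (radial_measure R d).
have h (t : R) : m1 [set` `]-oo, t]] = m2 [set` `]-oo, t]].
  rewrite /m1 /m2 /= /mrestr /pushforward /mscale radial_measure_itv//=.
  rewrite fineK// /surface_measure.
  case: ltP => t1.
    rewrite mule0 (_ : _ `&` _ = set0) ?measure0// -subset0 => x [] /=.
    rewrite in_itv/= /radial_coord => h _.
    have := sqr_ge0 (enorm x); lra.
  rewrite EFinM muleACA -EFinM divff// mul1e muleC -lebesgue_radial_coord_le//; last first.
    by rewrite le_min t1 ge_min lexx orbT/= (@le_trans _ _ 0).
  congr (lebesgue R d _); apply/seteqP; split => x /=; rewrite !in_itv/= le_min.
    move=> [-> [xb Ax]]; split => //=; rewrite /radial_coord.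
    have : enorm x ^+ 2 <= 1 by rewrite expr_le1 ?enorm_ge0.
    lra.
  by case=> /andP[-> _].
have fin (t : R) : (m1 [set` `]-oo, t]] < +oo)%E.
  apply: le_lt_trans (@lebesgue_unit_ball_lty R d).
  apply: le_measure; rewrite ?inE//.
    apply: measurableI => //.
    by rewrite -[X in measurable X]setTI; apply: measurable_radial_coord.
  by move=> x [_ []].
move=> mB; have := measure_eq_itvNyc h fin mB.
by rewrite /m1 /m2 /= /mrestr /pushforward /mscale /= fineK.
Qed.

End polar_measure.

HB.instance Definition _ (R : realType) (d : nat) :=
  Measure_isFinite.Build _ _ _ (@surface_measure R d) (@surface_measure_fin R d).

(** * Integration in polar coordinates *)

Section polar_integral.
Variables (R : realType) (d : nat).
Hypothesis d2 : (2 <= d)%N.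
Local Notation leb := (@lebesgue_measure R).
Local Notation sigma := (@surface_measure R d).

(** Finiteness depends on the hypothesis [d2], which inference cannot supply, so the structure is
    packed by hand. *)
Definition radial_finite_measure :
    {finite_measure set (measurableTypeR R) -> \bar R} :=
  HB.pack_for {finite_measure set (measurableTypeR R) -> \bar R}
    (density_measure leb (@radial_density R d)) (radial_measure R d)
    (Measure_isFinite.Build _ _ _ (radial_measure R d)
       (@radial_measure_fin R d d2)).

Definition polar_coord (x : euclid R d) : measurableTypeR R * euclid R d :=
  (radial_coord x, direction x).

Lemma measurable_polar_coord : measurable_fun setT polar_coord.
Proof.
apply/measurable_fun_pairP; split; first exact: measurable_radial_coord.
exact: measurable_direction.
Qed.

Lemma lebesgue_polar_coord (X : set (measurableTypeR R * euclid R d)) :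
  measurable X ->
  (radial_finite_measure \x sigma)%E X =
  lebesgue R d (polar_coord @^-1` X `&` @unit_ball R d).
Proof.
pose m' := pushforward_measure (mrestr (lebesgue R d) (@measurable_unit_ball R d))
  measurable_polar_coord.
apply: (product_measure_unique (m' := m')) => A B mA mB.
rewrite /m' /= /pushforward /mrestr muleC -lebesgue_radial_coord_direction//.
by congr (lebesgue R d _); apply/seteqP; split => x /=; tauto.
Qed.

Variables (phi : R -> R) (g : euclid R d -> R).
Hypotheses (mphi : measurable_fun [set: measurableTypeR R] phi)
  (mg : measurable_fun setT g).
Hypothesis iphi : leb.-integrable `[-1, 1]
  (fun t => (phi t * (1 + t) `^ ((d%:R - 2) / 2))%:E).
Hypothesis ig : sigma.-integrable setT (EFin \o g).

Let mI : measurable ([set` `[-1, 1]] : set (measurableTypeR R)).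
Proof. exact: measurable_itv. Qed.

Let C : R := (2 `^ (d%:R / 2 + 1))^-1.
(** Integrability of [phi] is assumed on [-1, 1] only; cut off there, it can be integrated over the
    whole line. *)
Let phi1 : R -> R := phi \_ `[-1, 1].

Let mphi1 : measurable_fun [set: measurableTypeR R] phi1.
Proof.
by apply/(measurable_restrictT _ (measurable_itv _)); exact: measurable_funTS.
Qed.

Let phi1E t : (phi1 t * radial_density d t)%:E =
  ((fun t => (C * (phi t * (1 + t) `^ ((d%:R - 2) / 2)))%:E) \_ `[-1, 1]) t.
Proof.
rewrite /phi1 /radial_density !patchE; case: ifP => _; last by rewrite mul0r.
by rewrite mulrCA.
Qed.

Let iphi1 : leb.-integrable setT (fun t => (phi1 t * radial_density d t)%:E).
Proof.
rewrite (_ : (fun t => _) =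
  (fun t => (C * (phi t * (1 + t) `^ ((d%:R - 2) / 2)))%:E) \_ `[-1, 1]).
  have h := @integrable_mkcond _ (measurableTypeR R) R leb `[-1, 1]
    (fun t => (C * (phi t * (1 + t) `^ ((d%:R - 2) / 2)))%:E) (measurable_itv _).
  by apply/h; exact: (integrableZl mI C iphi).
exact/funext.
Qed.

Let inu : radial_finite_measure.-integrable setT (EFin \o phi1).
Proof.
by apply: (integrable_density (m := leb) (@measurable_radial_density R d)
  (@radial_density_ge0 R d)).
Qed.

Let int_nu : (\int[radial_finite_measure]_t (phi1 t)%:E =
  C%:E * \int[leb]_(t in `[(-1)%R, 1%R]) (phi t * (1 + t) `^ ((d%:R - 2) / 2))%:E)%E.
Proof.
rewrite (integral_density (m := leb) (@measurable_radial_density R d)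
  (@radial_density_ge0 R d))//.
rewrite -integralZl// [RHS]integral_mkcond; apply: eq_integral => t _.
by rewrite phi1E.
Qed.

Let f (z : measurableTypeR R * euclid R d) : \bar R := (phi1 z.1 * g z.2)%:E.

Let mf : measurable_fun setT f.
Proof.
apply/measurable_EFinP; apply: measurable_funM.
  exact: (measurableT_comp mphi1 measurable_fst).
exact: (measurableT_comp mg measurable_snd).
Qed.

Let if_ : (radial_finite_measure \x sigma)%E.-integrable setT f.
Proof.
apply/(integrable12ltyP _ _ mf).
have h x : (\int[sigma]_y `|f (x, y)| = `|(phi1 x)%:E| * \int[sigma]_y `|(g y)%:E|)%E.
  have mge : measurable_fun setT (fun y => `|(g y)%:E|%E).
    by apply: measurableT_comp => //; exact/measurable_EFinP.
  rewrite -ge0_integralZl//.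
  by apply: eq_integral => y _; rewrite -EFinM -normrM.
under eq_integral do rewrite h.
have /integrableP[_ gfin] := ig; have /integrableP[mp pfin] := inu.
have mpe : measurable_fun setT (fun t => `|(phi1 t)%:E|%E).
  by apply: measurableT_comp.
rewrite ge0_integralZr//; last exact: integral_ge0.
by apply: lte_mul_pinfty => //; [exact: integral_ge0 | rewrite ge0_fin_numE// integral_ge0].
Qed.

Let intf : (\int[radial_finite_measure \x sigma]_z f z =
  C%:E * \int[leb]_(t in `[(-1)%R, 1%R]) (phi t * (1 + t) `^ ((d%:R - 2) / 2))%:E
  * \int[sigma]_y (g y)%:E)%E.
Proof.
rewrite -integral12_prod_meas1// -int_nu.
have gfin := integrable_fin_num measurableT ig.
rewrite -[X in (_ * X)%E]fineK// -integralZr//.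
apply: eq_integral => x _; rewrite /fubini_F /f /= fineK//.
by under eq_integral do rewrite EFinM; rewrite integralZl.
Qed.

Let D : set (measurableTypeR R * euclid R d) := [set` `]-oo, 1]] `*` setT.

Let mD : measurable D. Proof. by apply: measurableX => //; exact: measurable_itv. Qed.

Let ballE : @unit_ball R d = polar_coord @^-1` D.
Proof.
apply/seteqP; split => x; rewrite /D/unit_ball/=/radial_coord in_itv/=.
  move=> x1; split => //.
  have : enorm x ^+ 2 <= 1 by rewrite expr_le1 ?enorm_ge0.
  lra.
case=> h _; rewrite -(@expr_le1 _ 2)// ?enorm_ge0//.
by move: h; lra.
Qed.

Let f_ball x : unit_ball x ->
  (f \o polar_coord) x = (phi (radial_coord x) * g (direction x))%:E.
Proof.
move=> xb; rewrite /f /= /phi1 patchE ifT// inE/= in_itv/= /radial_coord.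
have : enorm x ^+ 2 <= 1 by rewrite expr_le1 ?enorm_ge0.
have := sqr_ge0 (enorm x).
by move=> h1 h2; apply/andP; split; lra.
Qed.

(** The restriction to subsets of [D] is essential: Lebesgue measure also charges t > 1, outside the
    ball, where the radial measure vanishes. *)
Let eq_meas : forall A, measurable A -> A `<=` D ->
  pushforward_measure (lebesgue R d) measurable_polar_coord A =
  (radial_finite_measure \x sigma)%E A.
Proof.
move=> A mA AD; rewrite lebesgue_polar_coord// /= /pushforward; congr (lebesgue R d _).
by rewrite ballE -preimage_setI setIidl.
Qed.

Let fD : f \_ D = f.
Proof.
apply/funext => -[t y]; rewrite patchE; case: ifPn => //.
rewrite notin_setE /D/= in_itv/= => h; rewrite /f/= /phi1 patchE ifN ?mul0r//.
by apply/negP; rewrite inE/= in_itv/= => /andP[_ t1]; apply: h.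
Qed.

Let ifb : (lebesgue R d).-integrable (@unit_ball R d) (f \o polar_coord).
Proof.
apply/integrableP; split.
  by apply: measurable_funTS; apply: measurableT_comp => //; exact: measurable_polar_coord.
have /integrableP[_] := if_.
have -> : (\int[radial_finite_measure \x sigma]_x `|f x| =
    \int[radial_finite_measure \x sigma]_(x in D) `|f x|)%E.
  rewrite -[in LHS]fD [RHS]integral_mkcond; apply: eq_integral => z _.
  by rewrite !patchE; case: ifP => // _; rewrite abse0.
rewrite -(eq_measure_integral _ eq_meas) ballE ge0_integral_pushforward//.
  exact: measurable_polar_coord.
by apply: measurable_funTS; exact: measurableT_comp.
Qed.

Lemma integrable_polar : (lebesgue R d).-integrable (@unit_ball R d)
  (fun x => (phi (radial_coord x) * g (direction x))%:E).
Proof.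
apply: eq_integrable ifb; first exact: measurable_unit_ball.
by move=> x; rewrite inE => /f_ball.
Qed.

Lemma Rintegral_polar :
  \int[lebesgue R d]_(x in @unit_ball R d) (phi (radial_coord x) * g (direction x)) =
  (2 `^ (d%:R / 2 + 1))^-1 *
  (\int[leb]_(t in `[-1, 1]) (phi t * (1 + t) `^ ((d%:R - 2) / 2))) *
  (\int[sigma]_(y in @unit_sphere R d) g y).
Proof.
rewrite /Rintegral -[X in X * _ * _]/(fine C%:E).
have pfin := integrable_fin_num mI iphi.
have gfin := integrable_fin_num measurableT ig.
rewrite -fineM//.
(* The complement of the sphere is a null set, so the whole space may serve as the domain in
   Fubini's theorem. *)
have -> : (\int[sigma]_(x in @unit_sphere R d) (g x)%:E = \int[sigma]_x (g x)%:E)%E.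
  have mS := @measurable_unit_sphere R d.
  rewrite [RHS](negligible_integral (N := ~` @unit_sphere R d))//.
  - by rewrite setTD setCK.
  - exact: measurableC.
  - exact: surface_measure_setC_sphere (leq_trans _ d2).
rewrite -fineM//; last by rewrite fin_numM.
rewrite -intf; congr fine.
transitivity (\int[lebesgue R d]_(x in @unit_ball R d) (f \o polar_coord) x)%E.
  by apply: eq_integral => x; rewrite inE => /f_ball.
rewrite ballE -integral_pushforward//; last 2 first.
- exact: measurable_polar_coord.
- by rewrite -ballE.
by rewrite (eq_measure_integral _ eq_meas) integral_mkcond fD.
Qed.

End polar_integral.

(** * Harmonic polynomials *)

Section harmonic_algebra.
Variables (R : realType) (d : nat).
Local Notation xvar i := (mpolyX R (mnm1 i)).
Local Notation homog k := (@ishomog1 d R k mdeg).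
Implicit Types (f g h : mpoly d R) (i : 'I_d) (k n : nat).

Definition sqnorm : mpoly d R := \sum_(i < d) xvar i ^+ 2.

Lemma mulX_mderivX i (m : multinom d) :
  xvar i * mderiv i (mpolyX R m) = (m i)%:R *: mpolyX R m.
Proof.
rewrite mderivX -scalerAr; have [->|m0] := eqVneq (m i) 0%N.
  by rewrite !scale0r.
by rewrite -mpolyXD addmC submK// lep1mP.
Qed.

Lemma euler k f : f \is homog k -> \sum_i xvar i * mderiv i f = k%:R *: f.
Proof.
move=> /dhomogP hf; rewrite {2}(mpolyE f) scaler_sumr.
under eq_bigr => i _.
  rewrite {1}(mpolyE f) linear_sum/= mulr_sumr.
  under eq_bigr => m _ do rewrite mderivZ -scalerAr mulX_mderivX.
  over.
rewrite exchange_big/=; rewrite big_seq [RHS]big_seq; apply: eq_bigr => m fm.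
rewrite -scaler_sumr -scaler_suml -natr_sum -mdegE hf//.
by rewrite !scalerA mulrC.
Qed.

(** For [k = 0] the derivative is 0, which is homogeneous of every degree, so the truncated
    predecessor does no harm. *)
Lemma mderiv_homog k f i : f \is homog k -> mderiv i f \is homog k.-1.
Proof.
move=> /dhomogP hf; rewrite (mpolyE f) linear_sum/= big_seq.
apply: rpred_sum => m fm; rewrite mderivZ mderivX; apply: rpredZ.
have [->|m0] := eqVneq (m i) 0%N; first by rewrite scale0r rpred0.
apply: rpredZ; rewrite dhomogX; apply/eqP.
have e : mdeg m = k := hf m fm.
have := mdegD (mnm_sub m (mnm1 i)) (mnm1 i).
by rewrite submK ?lep1mP// e mdeg1 addn1 => ->.
Qed.

Lemma laplacian_is_linear : linear (@laplacian R d).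
Proof.
move=> c f g; rewrite /laplacian scaler_sumr -big_split; apply: eq_bigr => i _.
by rewrite !linearP.
Qed.

HB.instance Definition _ := GRing.isLinear.Build R (mpoly d R) (mpoly d R) _
  (@laplacian R d) laplacian_is_linear.

Lemma laplacianZ c f : laplacian (c *: f) = c *: laplacian f.
Proof. exact: linearZ. Qed.

Lemma laplacian_homog k f : f \is homog k -> laplacian f \is homog (k - 2).
Proof.
by move=> hf; apply: rpred_sum => i _; rewrite subn2; do 2!apply: mderiv_homog.
Qed.

Lemma laplacianM f g : laplacian (f * g) =
  laplacian f * g + 2 *: (\sum_i mderiv i f * mderiv i g) + f * laplacian g.
Proof.
rewrite /laplacian scaler_sumr mulr_suml mulr_sumr -!big_split; apply: eq_bigr => i _.
by rewrite !(mderivM, mderivD) scaler_nat /=; ring.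
Qed.

Lemma mderiv_var i j : mderiv i (xvar j) = (i == j)%:R.
Proof.
rewrite mderivX mnm1E eq_sym; case: eqVneq => [->|_]; last by rewrite scale0r.
by rewrite -{1}[mnm1 j]add0m addmK mpolyX0 scale1r.
Qed.

Lemma mderiv_sqnorm i : mderiv i sqnorm = 2 *: xvar i.
Proof.
rewrite linear_sum/= (bigD1 i)//= big1 ?addr0 => [|j ji].
  by rewrite expr2 mderivM mderiv_var eqxx mulr1 mul1r scaler_nat.
by rewrite expr2 mderivM mderiv_var eq_sym (negbTE ji) mulr0 mul0r addr0.
Qed.

Lemma laplacian_sqnorm : laplacian sqnorm = (2 * d%:R) *: 1.
Proof.
rewrite /laplacian; under eq_bigr => i _.
  rewrite mderiv_sqnorm mderivZ mderiv_var eqxx; over.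
by rewrite sumr_const card_ord -scaler_nat scalerA mulrC.
Qed.

(** The cross term is 4 times the sum of the x_i d_i g, which is 4 k g by Euler's identity. *)
Lemma laplacian_sqnormM k g : g \is homog k ->
  laplacian (sqnorm * g) = (2 * d%:R + 4 * k%:R) *: g + sqnorm * laplacian g.
Proof.
move=> hg; rewrite laplacianM laplacian_sqnorm -scalerAl mul1r scalerDl.
congr (_ + _ + _).
under eq_bigr do rewrite mderiv_sqnorm -scalerAl.
rewrite -scaler_sumr (euler hg) !scalerA; congr (_ *: _); ring.
Qed.

Lemma sqnorm_homog : sqnorm \is homog 2.
Proof.
apply: rpred_sum => i _; rewrite (_ : 2%N = (1 * 2)%N)//; apply: dhomogMn.
by rewrite dhomogX; apply/eqP; exact: mdeg1.
Qed.

Lemma sqnormX_homog j k h : h \is homog k -> sqnorm ^+ j * h \is homog (2 * j + k).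
Proof. by move=> hh; apply: dhomogM => //; apply: dhomogMn; exact: sqnorm_homog. Qed.

(** For [0 < d] the coefficient is positive; the Fischer decomposition divides by it. *)
Lemma laplacian_sqnormX j k h : harmonics k h ->
  laplacian (sqnorm ^+ j.+1 * h) =
  (2 * j.+1%:R * (d%:R + 2 * k%:R + 2 * j%:R)) *: (sqnorm ^+ j * h).
Proof.
move=> [hh h0]; elim: j => [|j IH].
  rewrite expr1 (laplacian_sqnormM hh) h0 mulr0 addr0 expr0 mul1r.
  congr (_ *: _); ring.
rewrite exprS -mulrA (laplacian_sqnormM (sqnormX_homog _ hh)) IH -scalerAr mulrA -exprS.
by rewrite -scalerDl; congr (_ *: _); rewrite natrD natrM -!natr1; ring.
Qed.

Lemma mderiv_homog0 i f : f \is homog 0 -> mderiv i f = 0.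
Proof.
move=> /dhomogP hf; rewrite (mpolyE f) linear_sum/= big_seq big1// => m fm.
have : mdeg m = 0%N := hf m fm.
rewrite mdegE => /eqP; rewrite sum_nat_eq0 => /forallP/(_ i)/eqP mi0.
by rewrite mderivZ mderivX mi0 scale0r scaler0.
Qed.

(* Up to nonzero scalars, the Laplacian undoes the multiplication by |x|^2 on
   each |x|^(2j) h, so a decomposition of the Laplacian of f lifts to one of f
   modulo a harmonic polynomial. *)
Lemma fischer_decomposition n f : (0 < d)%N -> f \is homog n ->
  exists2 h : nat -> mpoly d R,
    (forall j, (j <= n./2)%N -> harmonics (n - 2 * j) (h j)) &
    f = \sum_(j < n./2.+1) sqnorm ^+ j * h j.
Proof.
move=> d0; elim/ltn_ind: n f => n IH f hf.
have [n2|n2] := ltnP n 2.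
  have n20 : n./2 = 0%N by lia.
  exists (fun=> f) => [j|]; rewrite n20; last by rewrite big_ord1 expr0 mul1r.
  rewrite leqn0 => /eqP->; rewrite muln0 subn0; split => //.
  rewrite /laplacian big1// => i _; apply: mderiv_homog0.
  by have := mderiv_homog i hf; rewrite (_ : n.-1 = 0%N)//; lia.
have [h hh lf] := IH (n - 2)%N ltac:(lia) _ (laplacian_homog hf).
pose c j : R := 2 * j.+1%:R * (d%:R + 2 * (n - 2 - 2 * j)%:R + 2 * j%:R).
have c0 j : c j != 0.
  rewrite gt_eqF// /c mulr_gt0//.
  by rewrite ltr_wpDr ?mulr_ge0// ltr_wpDr ?mulr_ge0// ltr0n.
have n2E : n./2 = (n - 2)./2.+1 by lia.
exists (fun j => if j is j'.+1 then (c j')^-1 *: h j'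
  else f - \sum_(j < n./2) (c j)^-1 *: (sqnorm ^+ j.+1 * h j)) => [[|j]|].
- move=> _; rewrite muln0 subn0; split.
    apply: rpredB => //; apply: rpred_sum => j _; apply: rpredZ.
    have [hj _] : harmonics (n - 2 - 2 * j) (h j) by apply: hh; rewrite -ltnS -n2E.
    have := sqnormX_homog j.+1 hj.
    by rewrite (_ : (2 * j.+1 + (n - 2 - 2 * j))%N = n)//; have := ltn_ord j; lia.
  rewrite (linearB (@laplacian R d)) (linear_sum (@laplacian R d))/= lf n2E.
  rewrite -sumrB big1// => j _.
  rewrite laplacianZ (laplacian_sqnormX _ (hh j (ltn_ord j))).
  by rewrite scalerA mulVf// scale1r subrr.
- move=> jn; rewrite (_ : n - 2 * j.+1 = n - 2 - 2 * j)%N; last by lia.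
  have [hj lj] : harmonics (n - 2 - 2 * j) (h j) by apply: hh; lia.
  by split; [exact: rpredZ | rewrite laplacianZ lj scaler0].
- rewrite big_ord_recl expr0 mul1r.
  under [X in _ + X]eq_bigr => i _ do rewrite lift0 /= -scalerAr.
  by rewrite subrK.
Qed.

End harmonic_algebra.

(** * Green's formula *)

Section green.
Variables (R : realType) (d : nat) (L : {linear mpoly d R -> R^o}).
Local Notation xvar i := (mpolyX R (mnm1 i)).
Local Notation homog k := (@ishomog1 d R k mdeg).

(** [L] stands for integration over the sphere. The left-hand sides, taken at F_i, add up to L(h
    Lap(g) - g Lap(h)) = 0; by Euler's identity the right-hand sides add up to (k + l + d - 2)(l -
    k) L(h g), where both factors are nonzero. *)
Lemma green k l (h g : mpoly d R) :
  (forall m f i, f \is homog m ->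
     L (mderiv i f) = (m%:R + d%:R - 1) * L (xvar i * f)) ->
  (2 <= d)%N -> k != l -> harmonics k h -> harmonics l g -> L (h * g) = 0.
Proof.
move=> hL d2 kl [hk lh] [gl lg].
pose F i := h * mderiv i g - g * mderiv i h.
have hF i : F i \is homog (k + l).-1.
  apply: rpredB.
    (* In degree 0 the derivative is 0, so truncation cannot spoil the degree of the product. *)
    case: l kl gl => [|l] kl gl; first by rewrite (mderiv_homog0 i gl) mulr0 rpred0.
    by rewrite addnS; apply: dhomogM => //; exact: (mderiv_homog i gl).
  case: k kl hk {lh} => [|k] kl hk; first by rewrite (mderiv_homog0 i hk) mulr0 rpred0.
  by rewrite addSn addnC; apply: dhomogM => //; exact: (mderiv_homog i hk).
have : \sum_i L (mderiv i (F i)) = 0.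
  rewrite -linear_sum/= (_ : \sum_i _ = h * laplacian g - g * laplacian h).
    by rewrite lh lg !mulr0 subrr linear0.
  rewrite /laplacian !mulr_sumr -sumrB; apply: eq_bigr => i _.
  by rewrite /F linearB/= !mderivM; ring.
under eq_bigr => i _ do rewrite (hL _ _ _ (hF i)).
rewrite -mulr_sumr -linear_sum/= (_ : \sum_i _ = (l%:R - k%:R) *: (h * g)); last first.
  rewrite scalerBl [in X in _ - X]mulrC !scalerAr -(euler hk) -(euler gl).
  by rewrite !mulr_sumr -sumrB; apply: eq_bigr => i _; rewrite /F; ring.
rewrite linearZ/= => /eqP; rewrite !mulf_eq0 => /orP[|/orP[|/eqP//]].
  by rewrite gt_eqF// subr_gt0 -natrD ltr1n; lia.
by rewrite subr_eq0 eqr_nat eq_sym (negbTE kl).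
Qed.

End green.

(** * Integrals of polynomials over the ball and the sphere *)

(** At [x = 0] the law of exponents fails only for exponents that cancel without both being 0, which
    nonnegativity excludes. *)
Lemma powRD_ge0 (R : realType) (x r s : R) : 0 <= r -> 0 <= s ->
  x `^ (r + s) = x `^ r * x `^ s.
Proof.
rewrite le_eqVlt => /predU1P[<-|r0]; first by rewrite add0r powRr0 mul1r.
by move=> s0; apply: powRD; rewrite gt_eqF// ltr_wpDr.
Qed.

Lemma integrable_powR1D (R : realType) (b : R) : 0 <= b ->
  (@lebesgue_measure R).-integrable `[-1, 1] (fun s => ((1 + s) `^ b)%:E).
Proof.
move=> b0; apply/integrableP; split.
  apply/measurable_EFinP/measurable_funTS.
  apply: (@measurableT_comp _ _ _ _ _ _ (@powR R ^~ _)).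
    exact: measurable_powR.
  by apply: measurable_funD => //; exact: measurable_cst.
under eq_integral do rewrite gee0_abs ?lee_fin ?powR_ge0//.
by rewrite integral_powR1D//= ltry.
Qed.

Section peval.
Variables (R : realType) (d : nat).
Local Notation leb := (@lebesgue_measure R).
Local Notation sigma := (@surface_measure R d).
Local Notation homog k := (@ishomog1 d R k mdeg).
Implicit Types (f g : mpoly d R) (x : euclid R d).

Lemma pevalE f x :
  peval f x = \sum_(m <- msupp f) mcoeff m f * \prod_i (tnth x i : R) ^+ m i.
Proof. exact: mevalE. Qed.

Lemma pevalD f g x : peval (f + g) x = peval f x + peval g x.
Proof. exact: mevalD. Qed.

Lemma pevalB f g x : peval (f - g) x = peval f x - peval g x.
Proof. exact: mevalB. Qed.

Lemma pevalZ c f x : peval (c *: f) x = c * peval f x.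
Proof. exact: mevalZ. Qed.

Lemma pevalM f g x : peval (f * g) x = peval f x * peval g x.
Proof. exact: mevalM. Qed.

Lemma peval_var i x : peval (mpolyX R (mnm1 i)) x = tnth x i.
Proof. exact: mevalXU. Qed.

Lemma peval_sqnorm x : peval (sqnorm R d) x = enorm x ^+ 2.
Proof.
rewrite sqr_enorm /peval/sqnorm rmorph_sum; apply: eq_bigr => i _ /=.
by rewrite rmorphXn /= mevalXU.
Qed.

Lemma measurable_peval f : measurable_fun [set: euclid R d] (peval f).
Proof.
rewrite (_ : peval f = fun x => \sum_(m <- msupp f)
  mcoeff m f * \prod_i (tnth x i : R) ^+ m i); last first.
  by apply/funext => x; rewrite pevalE.
apply: measurable_sum => m; apply: measurable_funM; first exact: measurable_cst.
apply: measurable_prod => i _; apply: measurable_funX.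
exact: measurable_tnth.
Qed.

Lemma peval_bounded f (s : R) : exists M : R,
  forall x, enorm x <= s -> `|peval f x| <= M.
Proof.
exists (\sum_(m <- msupp f) `|mcoeff m f| * \prod_i s ^+ m i) => x xs.
rewrite pevalE; apply: le_trans (ler_norm_sum _ _ _) _.
apply: ler_sum => m _; rewrite normrM ler_wpM2l// normr_prod.
apply: ler_prod => i _; rewrite normrX exprn_ge0//=.
by rewrite lerXn2r ?nnegrE ?(le_trans _ xs) ?enorm_ge0// normr_tnth_le_enorm.
Qed.

Lemma integrable_peval (mu : {measure set (euclid R d) -> \bar R})
    (D : set (euclid R d)) (s : R) f :
  measurable D -> (mu D < +oo)%E -> D `<=` [set x | enorm x <= s] ->
  mu.-integrable D (EFin \o peval f).
Proof.
move=> mD muD Ds; apply: measurable_bounded_integrable => //.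
  exact: measurable_funTS (@measurable_peval f).
have [M hM] := peval_bounded f s.
exists M; split; first exact: num_real.
by move=> y My x Dx; apply: le_trans (ltW My); apply: hM; exact: Ds.
Qed.

Lemma integrable_peval_ball f :
  (lebesgue R d).-integrable (@unit_ball R d) (EFin \o peval f).
Proof.
apply: (@integrable_peval _ _ 1); first exact: measurable_unit_ball.
  exact: lebesgue_unit_ball_lty.
by [].
Qed.

Lemma integrable_peval_sphere f :
  sigma.-integrable (@unit_sphere R d) (EFin \o peval f).
Proof.
have mS := @measurable_unit_sphere R d.
apply: (@integrable_peval _ _ 1) => //.
  by rewrite ltey_eq; apply/orP; left; exact: surface_measure_fin.
by move=> x /= ->.
Qed.

Lemma integrable_peval_sigma f : (0 < d)%N ->
  sigma.-integrable setT (EFin \o peval f).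
Proof.
move=> d0; have mS := @measurable_unit_sphere R d.
apply/(negligible_integrable (N := ~` @unit_sphere R d)) => //.
- exact: measurableC.
- by apply/measurable_EFinP; exact: measurable_peval.
- exact: surface_measure_setC_sphere.
- by rewrite setTD setCK; exact: integrable_peval_sphere.
Qed.

Definition sphere_int f : R := \int[sigma]_(x in @unit_sphere R d) peval f x.

Lemma sphere_int_linear : linear (sphere_int : mpoly d R -> R^o).
Proof.
move=> c f g; have mS := @measurable_unit_sphere R d.
rewrite /sphere_int /GRing.scale/= -RintegralZl//; last exact: integrable_peval_sphere.
rewrite -RintegralD//; last 2 first.
- rewrite (_ : _ \o _ = EFin \o peval (c *: f)); last first.
    by apply/funext => x /=; rewrite pevalZ.
  exact: integrable_peval_sphere.
- exact: integrable_peval_sphere.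
by apply: eq_Rintegral => x _; rewrite pevalD pevalZ.
Qed.

HB.instance Definition _ := GRing.isLinear.Build R (mpoly d R) R^o _
  sphere_int sphere_int_linear.

Lemma peval_scale k f (r : R) x : f \is homog k ->
  peval f (scale_tuple r x) = r ^+ k * peval f x.
Proof.
move=> /dhomogP hf; rewrite !pevalE mulr_sumr big_seq [RHS]big_seq.
apply: eq_bigr => m fm; rewrite mulrCA; congr (_ * _).
have <- : mdeg m = k := hf m fm.
rewrite mdegE -prodrXr -big_split/=; apply: eq_bigr => i _.
by rewrite tnth_mktuple exprMn.
Qed.

Lemma enorm_radial_coord x : enorm x = ((1 + radial_coord x) / 2) `^ 2^-1.
Proof.
rewrite (_ : (1 + radial_coord x) / 2 = enorm x ^+ 2); last by rewrite /radial_coord; field.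
by rewrite powR12_sqrt ?sqr_ge0// sqrtr_sqr ger0_norm// enorm_ge0.
Qed.

Lemma peval_polar k f x : f \is homog k ->
  peval f x = ((1 + radial_coord x) / 2) `^ (k%:R / 2) * peval f (direction x).
Proof.
move=> hf; rewrite -{1}(scale_direction x) (peval_scale _ _ hf); congr (_ * _).
by rewrite enorm_radial_coord -powR_mulrn ?powR_ge0// -powRrM [2^-1 * _]mulrC.
Qed.

Section homog_integral.
Variables (k : nat) (f : mpoly d R) (phi : R -> R).
Hypotheses (d2 : (2 <= d)%N) (hf : f \is homog k).
Hypothesis mphi : measurable_fun [set: measurableTypeR R] phi.
Hypothesis iphi : leb.-integrable `[-1, 1]
  (fun t => (phi t * ((1 + t) / 2) `^ (k%:R / 2) * (1 + t) `^ ((d%:R - 2) / 2))%:E).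

Let mphi' : measurable_fun [set: measurableTypeR R]
  (fun t => phi t * ((1 + t) / 2) `^ (k%:R / 2)).
Proof.
apply: measurable_funM => //.
apply: (@measurableT_comp _ _ _ _ _ _ (@powR R ^~ _)).
  exact: measurable_powR.
apply: measurable_funM => //.
by apply: measurable_funD.
Qed.

Lemma integrable_homog_ball : (lebesgue R d).-integrable (@unit_ball R d)
  (fun x => (peval f x * phi (radial_coord x))%:E).
Proof.
have := integrable_polar d2 mphi' (@measurable_peval f) iphi
  (integrable_peval_sigma _ (ltnW d2)).
apply: eq_integrable; first exact: measurable_unit_ball.
by move=> x _; rewrite [peval f x](peval_polar _ hf) /=; congr EFin; ring.
Qed.

(** The power with exponent k/2 is |x|^k written in t; what remains of [f] depends on the direction
    alone. *)
Lemma Rintegral_homog_ball :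
  \int[lebesgue R d]_(x in @unit_ball R d) (peval f x * phi (radial_coord x)) =
  (2 `^ (d%:R / 2 + 1))^-1 *
  (\int[leb]_(t in `[-1, 1])
    (phi t * ((1 + t) / 2) `^ (k%:R / 2) * (1 + t) `^ ((d%:R - 2) / 2))) *
  sphere_int f.
Proof.
rewrite -(Rintegral_polar d2 mphi' (@measurable_peval f) iphi
  (integrable_peval_sigma _ (ltnW d2))).
by apply: eq_Rintegral => x _; rewrite [peval f x](peval_polar _ hf) /=; ring.
Qed.

End homog_integral.

Definition ball_int (f : mpoly d R) : R :=
  \int[lebesgue R d]_(x in @unit_ball R d) peval f x.

Lemma ball_int_linear : linear (ball_int : mpoly d R -> R^o).
Proof.
move=> c f g; have mB := @measurable_unit_ball R d.
rewrite /ball_int /GRing.scale/= -RintegralZl//; last exact: integrable_peval_ball.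
rewrite -RintegralD//; last 2 first.
- rewrite (_ : _ \o _ = EFin \o peval (c *: f)); last first.
    by apply/funext => x /=; rewrite pevalZ.
  exact: integrable_peval_ball.
- exact: integrable_peval_ball.
by apply: eq_Rintegral => x _; rewrite pevalD pevalZ.
Qed.

HB.instance Definition _ := GRing.isLinear.Build R (mpoly d R) R^o _
  ball_int ball_int_linear.

(** The constant is the integral of r^(k+d-1) over [0, 1], computed here in the variable t. *)
Lemma ball_int_homog k f : (2 <= d)%N -> f \is homog k ->
  ball_int f =
  (k + d)%:R^-1 * sphere_int f.
Proof.
move=> d2 hf.
have b0 : 0 <= (d%:R - 2) / 2 :> R by rewrite divr_ge0// subr_ge0 ler_nat.
have kd0 : 0 <= k%:R / 2 + (d%:R - 2) / 2 :> R by rewrite addr_ge0.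
have e (t : R) : t \in `[-1, 1] ->
    1 * ((1 + t) / 2) `^ (k%:R / 2) * (1 + t) `^ ((d%:R - 2) / 2) =
    (2 `^ (k%:R / 2))^-1 * (1 + t) `^ (k%:R / 2 + (d%:R - 2) / 2).
  rewrite in_itv/= => /andP[t1 _].
  have t0 : 0 <= 1 + t by rewrite -lerBlDl sub0r.
  by rewrite mul1r powR_divr2// powRD_ge0//; ring.
have ip := integrable_powR1D kd0.
have mI : measurable ([set` `[-1, 1]] : set (measurableTypeR R)).
  exact: measurable_itv.
have kd : (k + d)%:R != 0 :> R by rewrite pnatr_eq0; lia.
have h : \int[leb]_(t in `[-1, 1]) ((1 + t) `^ (k%:R / 2 + (d%:R - 2) / 2)) =
    2 `^ ((k%:R + d%:R) / 2) / ((k%:R + d%:R) / 2).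
  rewrite /Rintegral integral_powR1D//=.
  rewrite (_ : 1 + 1 = 2)// (_ : k%:R / 2 + _ + 1 = (k%:R + d%:R) / 2)//.
  by field.
rewrite /ball_int; have := @Rintegral_homog_ball k f (cst 1) d2 hf (measurable_cst _).
under eq_Rintegral do rewrite mulr1.
move=> ->; last first.
  apply: eq_integrable (integrableZl mI (2 `^ (k%:R / 2))^-1 ip) => //.
  by move=> t; rewrite inE/= => /e ->.
congr (_ * _).
rewrite (@eq_Rintegral _ _ _ leb _ (fun t : R =>
  (2 `^ (k%:R / 2))^-1 * (1 + t) `^ (k%:R / 2 + (d%:R - 2) / 2))); last first.
  by move=> t; rewrite inE/= => /e.
rewrite RintegralZl// h natrD mulrDl !powRD_ge0// powRr1//; field.
by rewrite -natrD kd !gt_eqF ?powR_gt0.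
Qed.

End peval.

(** * Integrals of derivatives that vanish on the boundary of a ball *)

Section ball_boundary.
Variable R : realType.
Local Notation leb := (@lebesgue_measure R).

(** For negative [A] the set is empty, so a slice of parameter [A - t ^+ 2] needs no condition on
    its sign. *)
Definition ball_sqr d (A : R) : set (euclid R d) := [set x | enorm x ^+ 2 <= A].

Lemma measurable_ball_sqr d A : measurable (@ball_sqr d A).
Proof.
rewrite (_ : @ball_sqr d A = (fun x => enorm x ^+ 2) @^-1` [set` `]-oo, A]]).
  rewrite -[X in measurable X]setTI.
  exact: (measurable_funX 2 (@measurable_enorm R d)).
by apply/seteqP; split => x; rewrite /ball_sqr/= in_itv.
Qed.

Lemma ball_sqr_enorm d A : @ball_sqr d A `<=` [set x | enorm x <= Num.sqrt A].
Proof.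
by move=> x; rewrite /ball_sqr/= => /ler_wsqrtr; rewrite sqrtr_sqr ger0_norm ?enorm_ge0.
Qed.

Lemma lebesgue_ball_sqr d A : (lebesgue R d (@ball_sqr d A) < +oo)%E.
Proof.
(* The added 1 keeps the radius positive, as [lebesgue_cone] requires, also when [A <= 0] and the
   square root is 0. *)
have s1 : 0 < Num.sqrt A + 1 by rewrite ltr_wpDl ?sqrtr_ge0.
have mT : measurable [set: euclid R d] by [].
have := lebesgue_cone s1 mT; rewrite preimage_setT !setIT => h.
apply: (@le_lt_trans _ _ (lebesgue R d [set x | enorm x <= Num.sqrt A + 1]%R)).
  apply: le_measure; rewrite ?inE; first exact: measurable_ball_sqr.
    rewrite (_ : [set x | _] = @enorm R d @^-1` [set` `]-oo, Num.sqrt A + 1]]).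
      by rewrite -[X in measurable X]setTI; exact: measurable_enorm.
    by apply/seteqP; split => x; rewrite /= in_itv.
  by move=> x /ball_sqr_enorm/= /le_trans; apply; rewrite lerDl.
by rewrite h lte_mul_pinfty ?lebesgue_unit_ball_lty// lee_fin exprn_ge0 ?ltW.
Qed.

Lemma integral_deriv_poly (q : {poly R}) (a : R) :
  q.[Num.sqrt a] = q.[- Num.sqrt a] ->
  (\int[leb]_(t in [set t : R | t ^+ 2 <= a]%R) (q^`()%R.[t])%:E = 0)%E.
Proof.
move=> qa; have [a0|a0] := ltP a 0.
  rewrite (_ : [set t | _] = set0) ?integral_set0//.
  apply/seteqP; split => // t /= ta; have := le_lt_trans ta a0.
  by rewrite ltNge sqr_ge0.
rewrite (_ : [set t | _] = [set` `[- Num.sqrt a, Num.sqrt a]]); last first.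
  apply/seteqP; split => t; rewrite /= in_itv/= -ler_norml -sqrtr_sqr.
    exact: ler_wsqrtr.
  by rewrite ler_sqrt.
move: a0; rewrite le_eqVlt => /predU1P[<-|a0].
  by rewrite sqrtr0 oppr0 set_itv1 integral_set1.
have s0 : 0 < Num.sqrt a by rewrite sqrtr_gt0.
rewrite (@continuous_FTC2 _ _ (horner q))//.
- by rewrite qa subee.
- by rewrite gtrN.
- by apply: continuous_subspaceT => x; exact: continuous_horner.
- split.
  + by move=> x _; exact: derivable_horner.
  + by apply: cvg_at_right_filter; exact: continuous_horner.
  + by apply: cvg_at_left_filter; exact: continuous_horner.
- by move=> x _; rewrite derivE.
Qed.

(* The partial derivative along x_i of x^m (A - |x|^2), which vanishes on the
   boundary of the ball |x|^2 <= A.  The radius is a parameter because a slice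
   {x_0 = t} of this ball is the ball |x'|^2 <= A - t^2. *)
Definition boundary_poly d (m : multinom d) (i : 'I_d) (A : R) : mpoly d R :=
  mderiv i (mpolyX R m) * (A *: 1 - sqnorm R d) -
  2 *: (mpolyX R (mnm1 i) * mpolyX R m).

Definition mnm_behead d (m : multinom d.+1) : multinom d :=
  Multinom [tuple m (lift ord0 j) | j < d].

Lemma peval_mpolyX d (m : multinom d) (x : euclid R d) :
  peval (mpolyX R m) x = \prod_i (tnth x i : R) ^+ m i.
Proof. exact: mevalX. Qed.

Lemma peval_mderivX d (m : multinom d) i (x : euclid R d) :
  peval (mderiv i (mpolyX R m)) x =
  (m i)%:R * \prod_j (tnth x j : R) ^+ (m j - (i == j)).
Proof.
rewrite mderivX pevalZ peval_mpolyX; congr (_ * _); apply: eq_bigr => j _.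
by rewrite mnmBE mnm1E.
Qed.

Lemma peval_boundary_poly d (m : multinom d) i A (x : euclid R d) :
  peval (boundary_poly m i A) x =
  (m i)%:R * (\prod_j (tnth x j : R) ^+ (m j - (i == j))) * (A - enorm x ^+ 2) -
  2 * ((tnth x i : R) * \prod_j (tnth x j : R) ^+ m j).
Proof.
rewrite pevalB pevalM pevalB !pevalZ peval_mderivX peval_sqnorm pevalM peval_var.
by rewrite peval_mpolyX /peval meval1 mulr1.
Qed.

Lemma peval_boundary_poly_lift d (m : multinom d.+1) (i : 'I_d) A (t : R) (x : euclid R d) :
  peval (boundary_poly m (lift ord0 i) A) (tuple_cons (t, x)) =
  t ^+ m ord0 * peval (boundary_poly (mnm_behead m) i (A - t ^+ 2)) x.
Proof.
rewrite !peval_boundary_poly enorm_cons !big_ord_recl /= !tnth0 tnthS mnmE subn0.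
under eq_bigr => j _ do rewrite tnthS (inj_eq lift_inj).
under [X in _ - 2 * (_ * (_ * X))]eq_bigr => j _ do rewrite tnthS.
under [X in _ = _ * (_ * X * _ - _)]eq_bigr => j _ do rewrite mnmE.
under [X in _ = _ * (_ - 2 * (_ * X))]eq_bigr => j _ do rewrite mnmE.
ring.
Qed.

Lemma peval_boundary_poly0 d (m : multinom d.+1) A (t : R) (x : euclid R d) :
  peval (boundary_poly m ord0 A) (tuple_cons (t, x)) =
  ('X^(m ord0) * ((A - enorm x ^+ 2)%:P - 'X^2))^`().[t] *
  peval (mpolyX R (mnm_behead m)) x.
Proof.
rewrite peval_boundary_poly enorm_cons !big_ord_recl /= !tnth0 peval_mpolyX.
under eq_bigr => j _ do rewrite tnthS subn0.
under [X in _ - 2 * (_ * (_ * X))]eq_bigr => j _ do rewrite tnthS.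
under [X in _ = _ * X]eq_bigr => j _ do rewrite mnmE.
rewrite derivM derivB derivC !derivXn !hornerE/= !hornerMn !hornerXn subn1.
ring.
Qed.

(** Induction on [d], peeling off x_0. If x_i is another coordinate, the slice at fixed x_0 = t is
    an instance of the induction hypothesis with parameter A - t^2, up to a power of t. If i = 0,
    the order of integration is exchanged, and the inner integral is that of the derivative of a
    polynomial with equal values at both ends of the chord. *)
Lemma integral_boundary_poly d (m : multinom d) i A :
  (\int[lebesgue R d]_(x in @ball_sqr d A) (peval (boundary_poly m i A) x)%:E = 0)%E.
Proof.
elim: d m i A => [m []//|d IH] m i A.
set F := peval (boundary_poly m i A).
have mB := @measurable_ball_sqr d.+1 A.
set D := @tuple_cons R d @^-1` @ball_sqr d.+1 A.
have mD : measurable D.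
  by rewrite -[X in measurable X]setTI; exact: measurable_tuple_cons.
have mF : measurable_fun setT (F \o @tuple_cons R d).
  exact: measurableT_comp (@measurable_peval R d.+1 _) (@measurable_tuple_cons R d).
have iF : (leb \x lebesgue R d)%E.-integrable D (EFin \o (F \o @tuple_cons R d)).
  apply: measurable_bounded_integrable => //.
  - exact: (@lebesgue_ball_sqr d.+1 A).
  - exact: measurable_funTS.
  - have [M hM] := peval_bounded (boundary_poly m i A) (Num.sqrt A).
    exists M; split; first exact: num_real.
    by move=> y My p Dp; apply: le_trans (ltW My); apply: hM; exact: ball_sqr_enorm Dp.
transitivity (\int[leb \x lebesgue R d]_(p in D) (F (tuple_cons p))%:E)%E.
  have mFE : measurable_fun setT (EFin \o F).
    by apply/measurable_EFinP; exact: measurable_peval.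
  exact: (integral_pushforward (@measurable_tuple_cons R d) mFE iF mB).
rewrite integral_mkcond.
pose f := (EFin \o (F \o @tuple_cons R d)) \_ D.
have if_ : (leb \x lebesgue R d)%E.-integrable setT f.
  exact/(integrable_mkcond _ mD).
have fE t x : f (t, x) =
    ((fun x => (F (tuple_cons (t, x)))%:E) \_ (@ball_sqr d (A - t ^+ 2))) x.
  rewrite /f !patchE /= (_ : ((t, x) \in D) = (x \in ball_sqr (A - t ^+ 2)))//.
  by apply/idP/idP; rewrite !inE /D /ball_sqr/= enorm_cons lerBrDl.
rewrite -[LHS]/(\int[leb \x lebesgue R d]_z f z)%E -integral12_prod_meas1//.
case: (unliftP ord0 i) fE => [j|] ij fE.
  apply: integral0_eq => t _; rewrite /fubini_F.
  under eq_integral => x _ do rewrite fE.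
  rewrite -integral_mkcond /F ij.
  under eq_integral => x _ do rewrite peval_boundary_poly_lift EFinM.
  rewrite integralZl ?IH ?mule0//; first exact: measurable_ball_sqr.
  apply: (@integrable_peval _ _ _ _ (Num.sqrt (A - t ^+ 2))).
  - exact: measurable_ball_sqr.
  - exact: lebesgue_ball_sqr.
  - exact: ball_sqr_enorm.
rewrite Fubini//; apply: integral0_eq => x _.
rewrite (_ : (fun t => _) =
  (fun t => (('X^(m ord0) * ((A - enorm x ^+ 2)%:P - 'X^2))^`().[t] *
     peval (mpolyX R (mnm_behead m)) x)%:E)
    \_ [set t | t ^+ 2 <= A - enorm x ^+ 2]); last first.
  apply/funext => t; rewrite fE !patchE /F ij peval_boundary_poly0.
  rewrite (_ : (x \in _) = (t \in [set t | t ^+ 2 <= A - enorm x ^+ 2]))//.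
  by apply/idP/idP; rewrite !inE /ball_sqr/= !lerBrDl addrC.
rewrite -integral_mkcond.
set q := 'X^(m ord0) * _.
(* For a nonnegative radicand [q] vanishes at both ends; for a negative one the square root is 0 and
   the two ends coincide. *)
have qa : q.[Num.sqrt (A - enorm x ^+ 2)] = q.[- Num.sqrt (A - enorm x ^+ 2)].
  have [a0|a0] := leP 0 (A - enorm x ^+ 2); last first.
    by rewrite ler0_sqrtr ?oppr0// ltW.
  by rewrite /q !hornerE/= sqrrN (sqr_sqrtr a0) subrr !mulr0.
under eq_integral => t _ do rewrite EFinM.
have mS : measurable [set t : measurableTypeR R | t ^+ 2 <= A - enorm x ^+ 2].
  rewrite (_ : [set t | _] = (fun t : R => t ^+ 2) @^-1` [set` `]-oo, A - enorm x ^+ 2]]).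
    rewrite -[X in measurable X]setTI.
    by apply: (measurable_funX 2 (@measurable_id _ (measurableTypeR R) setT)).
  by apply/seteqP; split => t; rewrite /= in_itv.
rewrite integralZr//; first by rewrite (integral_deriv_poly qa) mul0e.
have : leb.-integrable `[- Num.sqrt (A - enorm x ^+ 2), Num.sqrt (A - enorm x ^+ 2)]
    (EFin \o horner q^`()).
  apply: continuous_compact_integrable; first exact: segment_compact.
  by apply: continuous_subspaceT => t; exact: continuous_horner.
apply: integrableS => //.
by move=> t /=; rewrite in_itv/= -ler_norml -sqrtr_sqr; exact: ler_wsqrtr.
Qed.

End ball_boundary.

(** * Integration by parts on the sphere *)

Section sphere_moments.
Variables (R : realType) (d : nat).
Local Notation homog k := (@ishomog1 d R k mdeg).
Local Notation xvar i := (mpolyX R (mnm1 i)).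

Lemma sphere_int_sqnorm f : sphere_int (f * sqnorm R d) = sphere_int f.
Proof.
apply: eq_Rintegral => x; rewrite inE => x1.
by rewrite pevalM peval_sqnorm x1 expr1n mulr1.
Qed.

(** Let u and v be the two integrals over the sphere and c = |m| + d - 1. The terms of the boundary
    polynomial are homogeneous of degrees |m| - 1, |m| + 1 and |m| + 1, so radial integration of it
    gives u/c - u/(c+2) - 2v/(c+2) = 0, that is u = c v. *)
Lemma sphere_int_mderivX (m : multinom d) i : (2 <= d)%N ->
  sphere_int (mderiv i (mpolyX R m)) =
  ((mdeg m)%:R + d%:R - 1) * sphere_int (xvar i * mpolyX R m).
Proof.
move=> d2; have hm : mpolyX R m \is homog (mdeg m) by rewrite dhomogX; apply/eqP.
have hxm : xvar i * mpolyX R m \is homog (1 + mdeg m).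
  by apply: dhomogM => //; rewrite dhomogX; apply/eqP; exact: mdeg1.
have : ball_int (boundary_poly m i (1 : R)) = 0.
  rewrite /ball_int /Rintegral (_ : @unit_ball R d = ball_sqr 1); last first.
    apply/seteqP; split => x; rewrite /unit_ball/ball_sqr/=.
      by move=> ?; rewrite expr_le1 ?enorm_ge0.
    by rewrite expr_le1 ?enorm_ge0.
  by rewrite integral_boundary_poly.
rewrite /boundary_poly scale1r mulrBr mulr1 !linearB linearZ/= /GRing.scale/=.
rewrite (ball_int_homog d2 hxm).
(* A constant monomial is treated apart, since |m| - 1 would be truncated; there the derivative is 0
   and the relation reads v = 0. *)
have [m0|m0] := posnP (mdeg m).
  rewrite (_ : mderiv i _ = 0); last by apply: mderiv_homog0; move: hm; rewrite m0.
  rewrite mul0r !linear0 addr0 sub0r => /eqP.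
  rewrite oppr_eq0 !mulf_eq0 pnatr_eq0 invr_eq0 pnatr_eq0/= => /eqP->.
  by rewrite mulr0.
have hd := mderiv_homog i hm.
rewrite (ball_int_homog d2 hd) (ball_int_homog d2 (dhomogM hd (@sqnorm_homog R d))).
rewrite sphere_int_sqnorm.
have k0 : ((mdeg m).-1 + d)%:R != 0 :> R by rewrite pnatr_eq0; lia.
have k1 : (1 + mdeg m + d)%:R != 0 :> R by rewrite pnatr_eq0; lia.
rewrite (_ : ((mdeg m).-1 + 2 + d = 1 + mdeg m + d)%N); last by lia.
have e1 : (mdeg m)%:R + d%:R - 1 = ((mdeg m).-1 + d)%:R :> R.
  by rewrite -{1}(prednK m0) -natr1 natrD; ring.
have e2 : (1 + mdeg m + d)%:R = ((mdeg m).-1 + d)%:R + 2 :> R.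
  by rewrite -natrD; congr (_%:R); lia.
rewrite e1; move: k0 k1; rewrite e2; move: ((mdeg m).-1 + d)%:R => c c0 c2.
move: (sphere_int _) (sphere_int _) => v u h.
have {}h : c * (c + 2) * (c^-1 * u - (c + 2)^-1 * u - 2 * ((c + 2)^-1 * v)) = 0.
  by rewrite h mulr0.
have : 2 * (u - c * v) = 0 by rewrite -h; field; rewrite c0 c2.
by move/eqP; rewrite mulf_eq0 pnatr_eq0/= subr_eq0 => /eqP.
Qed.

Lemma sphere_int_mderiv k f i : (2 <= d)%N -> f \is homog k ->
  sphere_int (mderiv i f) = (k%:R + d%:R - 1) * sphere_int (xvar i * f).
Proof.
move=> d2 /dhomogP hf.
have -> : mderiv i f = \sum_(m <- msupp f) mcoeff m f *: mderiv i (mpolyX R m).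
  by rewrite {1}(mpolyE f) linear_sum/=; apply: eq_bigr => m _; rewrite mderivZ.
have -> : xvar i * f = \sum_(m <- msupp f) mcoeff m f *: (xvar i * mpolyX R m).
  by rewrite {1}(mpolyE f) mulr_sumr; apply: eq_bigr => m _; rewrite scalerAr.
rewrite !linear_sum/= mulr_sumr big_seq [RHS]big_seq; apply: eq_bigr => m fm.
have <- : mdeg m = k := hf m fm.
by rewrite !linearZ/= sphere_int_mderivX// /GRing.scale/= mulrCA.
Qed.

Lemma sphere_int_harmonics k l (h g : mpoly d R) : (2 <= d)%N -> k != l ->
  harmonics k h -> harmonics l g -> sphere_int (h * g) = 0.
Proof.
move=> d2; exact: (@green R d (@sphere_int R d) k l h g
  (fun m f i => @sphere_int_mderiv m f i d2) d2).
Qed.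

End sphere_moments.

(** * Radial polynomials *)

Section radial.
Variables (R : realType) (d : nat).
Implicit Types (p q : {poly R}).
Local Notation rad := (@radial R d).
Local Notation arg := (2 *: sqnorm R d - 1).

Lemma radialD p q : rad (p + q) = rad p + rad q.
Proof. by rewrite /radial rmorphD hornerD. Qed.

Lemma radialM p q : rad (p * q) = rad p * rad q.
Proof. by rewrite /radial rmorphM hornerM. Qed.

Lemma radial0 : rad 0 = 0.
Proof. by rewrite /radial rmorph0 horner0. Qed.

Lemma radial1 : rad 1 = 1.
Proof. by rewrite /radial rmorph1 hornerC. Qed.

Lemma radialC (c : R) : rad c%:P = c *: 1.
Proof. by rewrite /radial map_polyC hornerC /= -alg_mpolyC. Qed.

Lemma radialZ (c : R) p : rad (c *: p) = c *: rad p.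
Proof. by rewrite -mul_polyC radialM radialC -scalerAl mul1r. Qed.

Lemma radialX : rad 'X = arg.
Proof. by rewrite /radial map_polyX hornerX. Qed.

(** Since (1 + t)/2 is |x|^2, the powers in the Fischer decomposition are radial polynomials. *)
Lemma radial_sqnormX j : rad ((2^-1 *: ('X + 1)) ^+ j) = sqnorm R d ^+ j.
Proof.
elim: j => [|j IH]; first by rewrite !expr0 radial1.
rewrite !exprS radialM IH radialZ radialD radialX radial1 subrK scalerA.
by rewrite mulVf ?scale1r// pnatr_eq0.
Qed.

Lemma peval_radial p (x : euclid R d) : peval (rad p) x = p.[radial_coord x].
Proof.
elim/poly_ind: p => [|p c IH].
  by rewrite radial0 horner0 /peval meval0.
rewrite radialD radialM radialX radialC pevalD pevalM IH pevalZ hornerMXaddC.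
rewrite pevalB pevalZ peval_sqnorm /peval !meval1 mulr1.
by [].
Qed.

Lemma msizeM_leq (f g : mpoly d R) a b :
  (mmeasure mdeg f <= a.+1)%N -> (mmeasure mdeg g <= b.+1)%N ->
  (mmeasure mdeg (f * g) <= (a + b).+1)%N.
Proof.
move=> fa gb; have [->|f0] := eqVneq f 0; first by rewrite mul0r mmeasure0.
have [->|g0] := eqVneq g 0; first by rewrite mulr0 mmeasure0.
rewrite msizeM// -subn1 leq_subLR; apply: leq_trans (leq_add fa gb) _; lia.
Qed.

Lemma msize_homog k (f : mpoly d R) : f \is @ishomog1 d R k mdeg ->
  (mmeasure mdeg f <= k.+1)%N.
Proof.
move=> /dhomogP hf; rewrite msizeE; apply/bigmax_leqP_seq => m fm _.
by rewrite ltnS; have <- : mdeg m = k := hf m fm.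
Qed.

Lemma msize_radial p j : (size p <= j.+1)%N ->
  (mmeasure mdeg (rad p) <= (2 * j).+1)%N.
Proof.
have marg : (mmeasure mdeg arg <= 3)%N.
  apply: leq_trans (mmeasureD_le _ _ _) _; rewrite geq_max mmeasureN mmeasure1 andbT.
  by apply: leq_trans (mmeasureZ_le _ _ _) _; exact: msize_homog (@sqnorm_homog R d).
elim: j p => [|j IH] p.
  move=> /size1_polyC ->; rewrite radialC.
  by apply: leq_trans (mmeasureZ_le _ _ _) _; rewrite mmeasure1.
elim/poly_ind: p => [|p c _ sp]; first by rewrite radial0 mmeasure0.
have sp' : (size p <= j.+1)%N.
  by move: sp; rewrite size_MXaddC; case: ifP => // /andP[/eqP-> _]; rewrite size_poly0.
rewrite radialD radialM radialX radialC.
apply: leq_trans (mmeasureD_le _ _ _) _; rewrite geq_max; apply/andP; split.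
  by rewrite mulnS addnC; exact: msizeM_leq (IH _ sp') marg.
by apply: leq_trans (mmeasureZ_le _ _ _) _; rewrite mmeasure1.
Qed.

End radial.

Lemma finite_poly_roots (F : fieldType) (p : {poly F}) : p != 0 ->
  finite_set [set t | root p t].
Proof.
have [n] := ubnP (size p); elim: n p => // n IH p pn p0.
have [[a pa]|no] := pselect (exists a, root p a); last first.
  rewrite (_ : [set t | _] = set0); first exact: finite_set0.
  by apply/seteqP; split => // t /= pt; apply: no; exists t.
have /factor_theorem[q pq] := pa.
have q0 : q != 0 by apply: contraNneq p0 => q0; rewrite pq q0 mul0r.
apply: (@sub_finite_set _ _ ([set a] `|` [set t | root q t])).
  move=> t /=; rewrite pq rootM root_XsubC => /orP[|/eqP]; [by right|by left].
rewrite finite_setU; split; first exact: finite_set1.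
apply: IH => //; move: pn; rewrite pq size_mul ?polyXsubC_eq0// size_XsubC.
by rewrite addn2.
Qed.

(** * The Jacobi weight *)

Section jacobi_weight.
Variable R : realType.
Local Notation leb := (@lebesgue_measure R).
Implicit Types (p : {poly R}) (mu b : R).

Definition jweight mu b (t : R) : R := (1 - t) `^ mu * (1 + t) `^ b.

Definition jint mu b p : R :=
  \int[leb]_(t in `[-1, 1]) (p.[t] * jweight mu b t).

Lemma measurable_horner p : measurable_fun [set: measurableTypeR R] (horner p).
Proof.
by apply: continuous_measurable_fun => x; exact: continuous_horner.
Qed.

Lemma measurable_powR_comp (g : R -> R) c :
  measurable_fun [set: measurableTypeR R] g ->
  measurable_fun [set: measurableTypeR R] (fun t => g t `^ c).
Proof.
by move=> mg; apply: (@measurableT_comp _ _ _ _ _ _ (@powR R ^~ c)).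
Qed.

(** For [b >= 0] the weight can be unbounded only at t = 1, through an integrable power of 1 - t;
    the other factors are bounded. *)
Lemma integrable_jweight mu b p : -1 < mu -> 0 <= b ->
  leb.-integrable `[-1, 1] (fun t => (p.[t] * jweight mu b t)%:E).
Proof.
move=> mu1 b0.
have mI : measurable ([set` `[-1, 1]] : set (measurableTypeR R)).
  exact: measurable_itv.
have := integrable_powR1B mu1.
pose h (t : R) : R := p.[t] * (1 + t) `^ b.
have mh : measurable_fun [set: measurableTypeR R] h.
  apply: measurable_funM; first exact: measurable_horner.
  by apply: measurable_powR_comp; apply: measurable_funD.
have bh : [bounded h t | t in ([set` `[-1, 1]] : set (measurableTypeR R))].
  exists ((\sum_(i < size p) `|p`_i|) * 2 `^ b); split; first exact: num_real.
  move=> y My t /=; rewrite in_itv/= => /andP[t1 t2]; apply: le_trans (ltW My).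
  rewrite /h normrM ler_pM// ?normr_ge0//.
    rewrite horner_coef; apply: le_trans (ler_norm_sum _ _ _) _.
    apply: ler_sum => i _; rewrite normrM ler_piMr// normrX exprn_ile1//.
    by rewrite ler_norml t1.
  rewrite ger0_norm ?powR_ge0// ge0_ler_powR ?nnegrE//; lra.
move=> i; have := integrableMr mI (measurable_funTS mh) bh i.
apply: eq_integrable => // t _ /=; rewrite -EFinM /h /jweight; congr EFin; ring.
Qed.

(** If the integral were 0, then p^2 times the weight would vanish almost everywhere on [-1, 1]. The
    weight is positive on ]-1, 1[, so this interval would be covered by a null set and the finitely
    many roots of [p]. *)
Lemma jint_gt0 mu b p : -1 < mu -> 0 <= b -> p != 0 -> 0 < jint mu b (p * p).
Proof.
move=> mu1 b0 p0; rewrite lt_neqAle eq_sym; apply/andP; split; last first.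
  apply: Rintegral_ge0 => t _; rewrite hornerM -expr2 mulr_ge0 ?sqr_ge0//.
  by rewrite /jweight mulr_ge0 ?powR_ge0.
apply/negP => /eqP jp0.
have mI : measurable ([set` `[-1, 1]] : set (measurableTypeR R)).
  exact: measurable_itv.
have ip := @integrable_jweight mu b (p * p) mu1 b0.
have /measurable_int mp := ip.
have : (\int[leb]_(t in `[(-1)%R, 1%R]) `|((p * p)%R.[t] * jweight mu b t)%R%:E| = 0)%E.
  under eq_integral => t _.
    rewrite gee0_abs; last first.
      rewrite lee_fin hornerM -expr2 mulr_ge0 ?sqr_ge0//.
      by rewrite /jweight mulr_ge0 ?powR_ge0.
    over.
  by rewrite -[LHS]fineK ?(integrable_fin_num mI ip)// -[fine _]/(jint mu b (p * p)) jp0.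
move=> /(ae_eq_integral_abs _ mI mp) [N [mN N0 sN]].
have cp : countable [set t | root p t] by exact/finite_set_countable/finite_poly_roots.
have mroot : measurable ([set t | root p t] : set (measurableTypeR R)).
  exact: countable_measurable.
have : leb [set` `]-1, 1[] = 0%E.
  apply: (@subset_measure0 _ _ _ leb _ (N `|` [set t | root p t])) => //.
  - exact: measurableU.
  - move=> t /=; rewrite in_itv/= => /andP[t1 t2].
    have [pt|pt] := boolP (root p t); [by right|left].
    apply: sN => /= h; have : t \in `[-1, 1] by rewrite in_itv/= !ltW.
    move=> /h; rewrite /cst => -[] /eqP; rewrite hornerM. rewrite !mulf_eq0 orbb.
    rewrite -rootE (negbTE pt)/= !powR_eq0.
    by rewrite subr_eq0 gt_eqF//= addrC gt_eqF// -ltrBlDr sub0r.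
  - exact: (@null_set_setU _ _ _ leb _ _ mN mroot N0 (countable_lebesgue_measure0 cp)).
rewrite lebesgue_measure_itv/= lte_fin (_ : -1 < 1); last by lra.
by move=> /eqP; rewrite -EFinB eqe; apply/negP; lra.
Qed.

End jacobi_weight.

(** * The inner product on the ball *)

Section weighted_ball.
Variables (R : realType) (d : nat) (mu : R).
Hypotheses (d2 : (2 <= d)%N) (mu1 : -1 < mu).
Local Notation leb := (@lebesgue_measure R).
Local Notation homog k := (@ishomog1 d R k mdeg).
Implicit Types (f g : mpoly d R) (p : {poly R}).

Definition wball_int f : R :=
  \int[lebesgue R d]_(x in @unit_ball R d) (peval f x * weight mu x).

Let phi p (t : R) : R := p.[t] * ((1 - t) / 2) `^ mu.

Let mphi p : measurable_fun [set: measurableTypeR R] (phi p).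
Proof.
apply: measurable_funM; first exact: measurable_horner.
apply: measurable_powR_comp; apply: measurable_funM => //.
by apply: measurable_funB.
Qed.

Let weightE p f (x : euclid R d) :
  peval (radial d p * f) x * weight mu x = peval f x * phi p (radial_coord x).
Proof.
rewrite pevalM peval_radial /phi /weight (_ : (1 - radial_coord x) / 2 = 1 - enorm x ^+ 2).
  by ring.
by rewrite /radial_coord; field.
Qed.

Let b0 : 0 <= (d%:R - 2) / 2 :> R.
Proof. by rewrite divr_ge0// subr_ge0 ler_nat. Qed.

Section homog.
Variables (p : {poly R}) (k : nat) (f : mpoly d R).
Hypothesis hf : f \is homog k.

Let phiE (t : R) : t \in `[-1, 1] ->
  phi p t * ((1 + t) / 2) `^ (k%:R / 2) * (1 + t) `^ ((d%:R - 2) / 2) =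
  (2 `^ mu * 2 `^ (k%:R / 2))^-1 * (p.[t] * jweight mu (k%:R / 2 + (d%:R - 2) / 2) t).
Proof.
rewrite in_itv/= => /andP[t1 t2].
rewrite /phi /jweight !powR_divr2; [|lra|lra].
by rewrite powRD_ge0// invfM; ring.
Qed.

Let mI : measurable ([set` `[-1, 1]] : set (measurableTypeR R)).
Proof. exact: measurable_itv. Qed.

Let ij := @integrable_jweight R mu (k%:R / 2 + (d%:R - 2) / 2) p mu1
  (addr_ge0 (divr_ge0 (ler0n R k) (ler0n R 2)) b0).

Let iphi : leb.-integrable `[-1, 1] (fun t =>
  (phi p t * ((1 + t) / 2) `^ (k%:R / 2) * (1 + t) `^ ((d%:R - 2) / 2))%:E).
Proof.
apply: eq_integrable (integrableZl mI (2 `^ mu * 2 `^ (k%:R / 2))^-1 ij) => //.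
by move=> t; rewrite inE/= => /phiE ->.
Qed.

Lemma integrable_wball_homog : (lebesgue R d).-integrable (@unit_ball R d)
  (fun x => (peval (radial d p * f) x * weight mu x)%:E).
Proof.
have := integrable_homog_ball d2 hf (mphi p) iphi.
apply: eq_integrable; first exact: measurable_unit_ball.
by move=> x _; rewrite weightE.
Qed.

(** In the constant, the exponent [mu] comes from the weight ((1-t)/2)^mu, d/2 + 1 from the radial
    measure, and k/2 from |x|^k. *)
Lemma wball_int_homog : wball_int (radial d p * f) =
  (2 `^ (mu + d%:R / 2 + 1))^-1 / 2 `^ (k%:R / 2) *
  jint mu (k%:R / 2 + (d%:R - 2) / 2) p * sphere_int f.
Proof.
rewrite /wball_int; under eq_Rintegral => x _ do rewrite weightE.
rewrite (Rintegral_homog_ball d2 hf (mphi p) iphi).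
congr (_ * _).
rewrite (@eq_Rintegral _ _ _ leb _ (fun t : R => (2 `^ mu * 2 `^ (k%:R / 2))^-1 *
  (p.[t] * jweight mu (k%:R / 2 + (d%:R - 2) / 2) t))); last first.
  by move=> t; rewrite inE/= => /phiE.
rewrite RintegralZl// mulrA; congr (_ * _).
rewrite -addrA [2 `^ (mu + _)]powRD; last by rewrite pnatr_eq0 implybT.
by rewrite !invfM; ring.
Qed.

End homog.

(** The case [p = 1], [k = 0] above gives integrability of the weight itself, and a polynomial is
    bounded on the ball. *)
Lemma integrable_wball f : (lebesgue R d).-integrable (@unit_ball R d)
  (fun x => (peval f x * weight mu x)%:E).
Proof.
have mB := @measurable_unit_ball R d.
have h1 : (1 : mpoly d R) \is homog 0 by exact: dhomog1.
have := integrable_wball_homog 1 h1; rewrite radial1 mul1r => iw.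
have {}iw : (lebesgue R d).-integrable (@unit_ball R d) (fun x => (weight mu x)%:E).
  by apply: eq_integrable iw => // x _; rewrite /peval meval1 mul1r.
have [M hM] := peval_bounded f 1.
apply: (integrableMr mB (measurable_funTS (@measurable_peval R d f)) _ iw).
exists M; split; first exact: num_real.
by move=> y My x xB; apply: le_trans (ltW My); exact: hM.
Qed.

Lemma wball_int_linear : linear (wball_int : mpoly d R -> R^o).
Proof.
move=> c f g; have mB := @measurable_unit_ball R d.
rewrite /wball_int /GRing.scale/= -RintegralZl//; last exact: integrable_wball.
rewrite -RintegralD//; last 2 first.
- rewrite (_ : _ \o _ = (fun x => (peval (c *: f) x * weight mu x)%:E)); last first.
    by apply/funext => x /=; rewrite pevalZ mulrA.
  exact: integrable_wball.
- exact: integrable_wball.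
by apply: eq_Rintegral => x _; rewrite pevalD pevalZ mulrDl mulrA.
Qed.

Variable lambda : R.

(** The inner product depends on its two arguments only through their product, so a linear form of
    one argument carries it. *)
Definition ball_form f : R :=
  (ball_mass d mu)^-1 * wball_int f + lambda / sphere_area R d * sphere_int f.

Lemma ball_ipE f g : ball_ip mu lambda f g = ball_form (f * g).
Proof.
rewrite /ball_ip /ball_form /wball_int /sphere_int.
by congr (_ * _ + _ * _); apply: eq_Rintegral => x _; rewrite pevalM.
Qed.

Lemma ball_form_linear : linear (ball_form : mpoly d R -> R^o).
Proof.
move=> c f g; rewrite /ball_form wball_int_linear sphere_int_linear.
by rewrite /GRing.scale/=; ring.
Qed.

Lemma ball_massE : ball_mass d mu =
  (2 `^ (mu + d%:R / 2 + 1))^-1 * jint mu ((d%:R - 2) / 2) 1 * sphere_area R d.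
Proof.
have h1 : (1 : mpoly d R) \is homog 0 by exact: dhomog1.
have := wball_int_homog 1 h1; rewrite radial1 mul1r mul0r powRr0 divr1 add0r.
rewrite (_ : sphere_int 1 = sphere_area R d); last first.
  by apply: eq_Rintegral => x _; rewrite /peval meval1.
move=> <-; apply: eq_Rintegral => x _.
by rewrite /peval meval1 mul1r.
Qed.

Hypothesis area0 : sphere_area R d != 0.

Lemma sphere_area_gt0 : 0 < sphere_area R d.
Proof. by rewrite lt_neqAle eq_sym area0/= Rintegral_ge0. Qed.

Lemma ball_mass_gt0 : 0 < ball_mass d mu.
Proof.
rewrite ball_massE mulr_gt0 ?sphere_area_gt0// mulr_gt0 ?invr_gt0 ?powR_gt0//.
by have := jint_gt0 mu1 b0 (oner_neq0 {poly R}); rewrite mulr1.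
Qed.

Lemma c_gt0 : 0 < c_ d mu.
Proof.
by rewrite /c_ mulr_gt0 ?invr_gt0 ?powR_gt0// divr_gt0// ?sphere_area_gt0 ?ball_mass_gt0.
Qed.

(** For [k = l] the exponent of 1 + t is k + (d-2)/2, which is [beta_]. On the sphere t = 1, and as
    lambda is [c_ / 2 ^+ k] times [M_], the sphere term becomes the point mass with the same factor
    as the Jacobi integral. *)
Lemma ball_form_harmonics k l p h g : harmonics k h -> harmonics l g ->
  ball_form (radial d p * (h * g)) =
  (k == l)%:R * (c_ d mu / 2 ^+ k *
    (jint mu (beta_ R d k) p + M_ d mu lambda k * p.[1])) * sphere_ip h g.
Proof.
move=> hk gl; have hg : h * g \is homog (k + l).
  by apply: dhomogM; [exact: hk.1 | exact: gl.1].
have -> : sphere_ip h g = (sphere_area R d)^-1 * sphere_int (h * g).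
  by congr (_ * _); apply: eq_Rintegral => x _; rewrite pevalM.
rewrite /ball_form (wball_int_homog p hg).
have -> : sphere_int (radial d p * (h * g)) = p.[1] * sphere_int (h * g).
  have mS := @measurable_unit_sphere R d.
  rewrite /sphere_int -RintegralZl//; last exact: integrable_peval_sphere.
  apply: eq_Rintegral => x; rewrite inE => x1; rewrite pevalM peval_radial /radial_coord.
  by rewrite x1 expr1n mulr1 (_ : 2 - 1 = 1)//; ring.
have [kl|kl] := eqVneq k l; last first.
  by rewrite (sphere_int_harmonics d2 kl hk gl) !mulr0 addr0.
have -> : (k + l)%:R / 2 = k%:R :> R by rewrite -kl natrD; field.
rewrite -/(beta_ R d k) powR_mulrn// mul1r /M_.
have := c_gt0; rewrite /c_ => cp.
have om := ball_mass_gt0.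
have pw : 0 < 2 `^ (mu + d%:R / 2 + 1) :> R by rewrite powR_gt0.
field.
by rewrite area0 !gt_eqF ?exprn_gt0.
Qed.

End weighted_ball.

(** * The mutually orthogonal basis *)

Section basis.
Variables (R : realType) (d : nat) (mu lambda : R).
Variables (a : nat -> nat) (Y : forall k : nat, 'I_(a k) -> mpoly d R).
Variable q : nat -> nat -> {poly R}.
Hypotheses (d2 : (2 <= d)%N) (mu1 : -1 < mu) (lambda0 : 0 < lambda).
Hypothesis Y_basis : forall k : nat, is_basis (@harmonics R d k) (@Y k).
Hypothesis Y_orthonormal : forall (k : nat) (nu eta : 'I_(a k)),
  sphere_ip (Y nu) (Y eta) = (nu == eta)%:R.
Hypothesis q_orthopoly : forall k j : nat,
  is_orthopoly (jacobi_mass_ip mu (beta_ R d k) (M_ d mu lambda k)) j (q k j).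
Local Notation ip := (@ball_ip R d mu lambda).
Local Notation form := (@ball_form R d mu lambda).
Local Notation homog k := (@ishomog1 d R k mdeg).
Local Notation bp := (@ball_poly R d a Y q).
Implicit Types (f g v : mpoly d R).

(** [sphere_ip] divides by the area and the inverse of 0 is 0, so a zero area would make it vanish
    identically. This contradicts orthonormality in degree 0, where the constant 1 forces the basis
    to be nonempty. *)
Lemma sphere_area_neq0 : sphere_area R d != 0.
Proof.
have [_ _ span0] := Y_basis 0.
have h1 : harmonics 0 (1 : mpoly d R).
  have h0 : (1 : mpoly d R) \is homog 0 by exact: dhomog1.
  by split=> //; rewrite /laplacian big1// => i _; rewrite (mderiv_homog0 i h0) linear0.
apply/negP => /eqP s0.
have [c c1] := span0 _ h1.
case: (posnP (a 0)) => [a0|a0].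
  have /eqP := c1; rewrite big1 ?oner_eq0// => i _.
  by have := ltn_ord i; rewrite {2}a0.
have := Y_orthonormal (Ordinal a0) (Ordinal a0).
rewrite /sphere_ip s0 invr0 mul0r eqxx => /eqP.
by rewrite eq_sym oner_eq0.
Qed.

Let area0 := sphere_area_neq0.

Lemma jacobi_ipE b (f g : {poly R}) : jacobi_ip mu b f g = jint mu b (f * g).
Proof.
by apply: eq_Rintegral => t _; rewrite hornerM /jweight !mulrA.
Qed.

Lemma jacobi_mass_ipC b M (f g : {poly R}) :
  jacobi_mass_ip mu b M f g = jacobi_mass_ip mu b M g f.
Proof. by rewrite /jacobi_mass_ip !jacobi_ipE [f * g]mulrC mulrAC. Qed.

Lemma q_orthogonal k i j : jacobi_mass_ip mu (beta_ R d k) (M_ d mu lambda k) (q k j) (q k i) =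
  (j == i)%:R * h_tilde d mu lambda q k j.
Proof.
have [->|ji] := eqVneq j i; first by rewrite mul1r.
rewrite mul0r; case: (ltngtP i j) ji => // ij _.
  by have [_] := q_orthopoly k j; apply; have [-> _] := q_orthopoly k i.
rewrite jacobi_mass_ipC.
by have [_] := q_orthopoly k i; apply; have [-> _] := q_orthopoly k j.
Qed.

Lemma h_tilde_gt0 k j : 0 < h_tilde d mu lambda q k j.
Proof.
rewrite /h_tilde /jacobi_mass_ip jacobi_ipE ltr_wpDr//.
  rewrite -mulrA -expr2 mulr_ge0 ?sqr_ge0// /M_ mulr_ge0 ?ltW//.
  by rewrite divr_gt0 ?exprn_gt0// (c_gt0 d2 mu1).
apply: jint_gt0 => //; last first.
  by rewrite -size_poly_gt0; have [-> _] := q_orthopoly k j.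
by rewrite /beta_ addr_ge0// divr_ge0// subr_ge0 ler_nat.
Qed.

(** The same polynomial as [ball_poly], indexed by the degree k of its harmonic factor, which keeps
    the subtraction [n - 2 * j] out of the type of [nu]. *)
Definition solid k j (nu : 'I_(a k)) : mpoly d R := radial d (q k j) * Y nu.

Lemma Y_harmonics k (nu : 'I_(a k)) : harmonics k (Y nu).
Proof. by have [+ _ _] := Y_basis k; apply. Qed.

Lemma solid_orthogonal k l j i (nu : 'I_(a k)) (eta : 'I_(a l)) :
  ip (solid j nu) (solid i eta) =
  c_ d mu / 2 ^+ k * h_tilde d mu lambda q k j *
  (k == l)%:R * (j == i)%:R * (nu == eta :> nat)%:R.
Proof.
rewrite ball_ipE /solid mulrACA -radialM.
rewrite (ball_form_harmonics d2 mu1 lambda area0 _ (Y_harmonics nu) (Y_harmonics eta)).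
have [kl|kl] := eqVneq k l; last by rewrite !(mul0r, mulr0).
(* Only after [l] has been replaced by [k] do [nu] and [eta] have the same type. *)
case: l / kl eta => eta.
rewrite Y_orthonormal mul1r mulr1 -(inj_eq val_inj).
have := q_orthogonal k i j; rewrite /jacobi_mass_ip jacobi_ipE hornerM mulrA => ->.
by ring.
Qed.

Lemma ball_polyE n j (nu : 'I_(a (n - 2 * j)%N)) : bp nu = solid j nu.
Proof. by []. Qed.

Lemma ball_poly_orthogonal n m j k
    (nu : 'I_(a (n - 2 * j)%N)) (eta : 'I_(a (m - 2 * k)%N)) :
  (2 * j <= n)%N -> (2 * k <= m)%N ->
  ip (bp nu) (bp eta) = H_tilde d mu lambda q n j *
    (n == m)%:R * (j == k)%:R * (nu == eta :> nat)%:R.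
Proof.
move=> jn km; rewrite !ball_polyE solid_orthogonal -/(H_tilde d mu lambda q n j).
have [jk|] := eqVneq j k; last by rewrite !(mulr0, mul0r).
(* Both subtractions are exact, so for equal j and k the harmonic degrees agree exactly when n and m
   do. *)
by rewrite (_ : (n - 2 * j == m - 2 * k)%N = (n == m))//; lia.
Qed.

Lemma H_tilde_neq0 n j : H_tilde d mu lambda q n j != 0.
Proof.
rewrite gt_eqF// mulr_gt0 ?h_tilde_gt0// divr_gt0 ?exprn_gt0//.
exact: c_gt0.
Qed.

Section span.
Variables (n : nat) (S : mpoly d R -> Prop).
Hypotheses (S0 : S 0) (Slin : forall c f g, S f -> S g -> S (c *: f + g)).
Hypothesis Sbp : forall m j (nu : 'I_(a (m - 2 * j)%N)),
  (m <= n)%N -> (2 * j <= m)%N -> S (bp nu).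

Let Ssolid k j (nu : 'I_(a k)) : (k + 2 * j <= n)%N -> S (solid j nu).
Proof.
(* [k] and [k + 2 * j - 2 * j] are equal only propositionally, so the degree is generalized before
   the type of [nu] is rewritten. *)
move=> kn; have h k' (nu' : 'I_(a k')) : k' = (k + 2 * j - 2 * j)%N -> S (solid j nu').
  by move=> e; move: nu'; rewrite e => nu'; apply: Sbp nu' kn (leq_addl _ _).
by apply: h; rewrite addnK.
Qed.

Let Ssum (I : finType) (c : I -> R) (F : I -> mpoly d R) :
  (forall i, S (F i)) -> S (\sum_i c i *: F i).
Proof.
by move=> SF; elim/big_rec: _ => // i f _ Sf; exact: Slin.
Qed.

(** Since [q k s] has degree exactly s, subtracting a multiple of it removes the coefficient of
    degree s of [p], and the induction on the size goes on. *)
Lemma span_radial k s (p : {poly R}) (nu : 'I_(a k)) : (size p <= s)%N ->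
  (forall j, (j < s)%N -> (k + 2 * j <= n)%N) -> S (radial d p * Y nu).
Proof.
elim: s p => [|s IH] p ps ks.
  by move: ps; rewrite leqn0 size_poly_eq0 => /eqP->; rewrite radial0 mul0r.
have [qs _] := q_orthopoly k s.
have qs0 : (q k s)`_s != 0.
  by rewrite -[s in _`_s]/(s.+1.-1) -qs lead_coef_eq0 -size_poly_gt0 qs.
pose p' := p - (p`_s / (q k s)`_s) *: q k s.
have -> : p = (p`_s / (q k s)`_s) *: q k s + p' by rewrite /p' addrC subrK.
rewrite radialD radialZ mulrDl -scalerAl; apply: Slin; first exact/Ssolid/ks.
apply: IH => [|j js]; last exact/ks/ltnW.
apply/leq_sizeP => i; rewrite leq_eqVlt coefB coefZ => /predU1P[<-|si].
  by rewrite divfK ?subrr.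
by rewrite (nth_default _ (leq_trans ps si)) [(q k s)`_i]nth_default ?qs// mulr0 subrr.
Qed.

Lemma span_homog m f : (m <= n)%N -> f \is homog m -> S f.
Proof.
move=> mn hf; have [h hh ->] := fischer_decomposition (ltnW d2) hf.
have -> : \sum_(j < m./2.+1) sqnorm R d ^+ j * h j =
  \sum_(j < m./2.+1) 1 *: (sqnorm R d ^+ j * h j).
  by apply: eq_bigr => j _; rewrite scale1r.
apply: Ssum => j; have [_ _ sp] := Y_basis (m - 2 * j).
have [c ->] := sp _ (hh j (ltn_ord j)).
rewrite mulr_sumr; under eq_bigr do rewrite -scalerAr.
apply: Ssum => nu; rewrite -radial_sqnormX; apply: (@span_radial _ j.+1).
  apply: leq_trans (size_poly_exp_leq _ _) _; rewrite ltnS -[leqRHS]mul1n leq_mul2r.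
  apply/orP; right; rewrite -subn1 leq_subLR addn1.
  by apply: leq_trans (size_scale_leq _ _) _; rewrite size_XaddC.
by move=> i ij; have := ltn_ord j; lia.
Qed.

(** Spanning takes the form of an induction principle: any linear property [S] of the Q's of degree
    at most n passes to all polynomials of degree at most n. It is used both for orthogonality to
    lower degrees and for the Fourier expansion. *)
Lemma span_msize f : (mmeasure mdeg f <= n.+1)%N -> S f.
Proof.
move=> fn; rewrite (pihomog_partitionE (mf := mdeg) fn).
have -> : \sum_(m < n.+1) pihomog mdeg m f = \sum_(m < n.+1) 1 *: pihomog mdeg m f.
  by apply: eq_bigr => j _; rewrite scale1r.
apply: Ssum => m; apply: (@span_homog m); first by rewrite -ltnS.
exact: pihomogP.
Qed.

End span.

Lemma ip_linl c f g v : ip (c *: f + g) v = c * ip f v + ip g v.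
Proof. by rewrite !ball_ipE mulrDl -scalerAl ball_form_linear. Qed.

Lemma ip_sym f g : ip f g = ip g f.
Proof. by rewrite !ball_ipE mulrC. Qed.

Lemma ip0l v : ip 0 v = 0.
Proof.
have := ip_linl 1 0 0 v; rewrite scaler0 addr0 mul1r => /eqP.
by rewrite -subr_eq0 opprD addNKr oppr_eq0 => /eqP.
Qed.

Lemma ip_suml (I : finType) (c : I -> R) (F : I -> mpoly d R) v :
  ip (\sum_i c i *: F i) v = \sum_i c i * ip (F i) v.
Proof.
elim/big_rec2: _ => [|i x f _ <-]; first exact: ip0l.
by rewrite ip_linl.
Qed.

Lemma msize_ball_poly n j (nu : 'I_(a (n - 2 * j)%N)) : (2 * j <= n)%N ->
  (mmeasure mdeg (bp nu) <= n.+1)%N.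
Proof.
move=> jn; have [sq _] := q_orthopoly (n - 2 * j) j.
have sr : (mmeasure mdeg (radial d (q (n - 2 * j) j)) <= (2 * j).+1)%N.
  by apply: msize_radial; rewrite sq.
have sY := msize_homog (Y_harmonics nu).1.
by have := msizeM_leq sr sY; rewrite subnKC.
Qed.

Local Notation index n := {j : 'I_(n./2).+1 & 'I_(a (n - 2 * j)%N)}.

Let tag_le m (i : index m) : (2 * tag i <= m)%N.
Proof. by have := ltn_ord (tag i); lia. Qed.

Lemma ball_poly_index_orthogonal m (i j : index m) :
  ip (bp (tagged i)) (bp (tagged j)) = H_tilde d mu lambda q m (tag i) * (i == j)%:R.
Proof.
rewrite ball_poly_orthogonal// eqxx mulr1.
have [->|] := eqVneq i j; first by rewrite !eqxx !mulr1.
case: i j => ti ni [tj nj] /= ij.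
have [tij|] := eqVneq (ti : nat) tj; last by rewrite !(mul0r, mulr0).
have {}tij := val_inj tij; case: tj / tij nj ij => nj ij.
have [nij|] := eqVneq (ni : nat) nj; last by rewrite !(mul0r, mulr0).
by rewrite (val_inj nij) eqxx in ij.
Qed.

Definition fourier n f : mpoly d R :=
  \sum_(m < n.+1) \sum_(i : index m)
    (ip f (bp (tagged i)) / H_tilde d mu lambda q m (tag i)) *: bp (tagged i).

(** Both sides are linear in [f], so it suffices to take one of the Q's, for which orthogonality
    leaves a single term. *)
Lemma fourierE n f : (mmeasure mdeg f <= n.+1)%N -> fourier n f = f.
Proof.
move: f; apply: span_msize.
- rewrite /fourier big1// => m _; rewrite big1// => i _.
  by rewrite ip0l mul0r scale0r.
- move=> c f g Sf Sg; rewrite -{2}Sf -{2}Sg /fourier scaler_sumr -big_split.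
  apply: eq_bigr => m _; rewrite scaler_sumr -big_split; apply: eq_bigr => i _.
  by rewrite /= ip_linl mulrDl scalerDl scalerA mulrA.
- move=> m j nu mn jm; rewrite /fourier.
  have jm' : (j < m./2.+1)%N by lia.
  pose i : index m := Tagged (fun j : 'I_(m./2).+1 => 'I_(a (m - 2 * j)%N))
    (nu : 'I_(a (m - 2 * Ordinal jm')%N)).
  have mn' : (m < n.+1)%N by rewrite ltnS.
  rewrite (bigD1 (Ordinal mn'))//= [X in _ + X]big1 ?addr0 => [|m' mm']; last first.
    rewrite big1// => i' _; rewrite ball_poly_orthogonal//.
    rewrite -[m]/(val (Ordinal mn')) (inj_eq val_inj) eq_sym (negbTE mm').
    by rewrite !(mulr0, mul0r) scale0r.
  rewrite (bigD1 i)//= big1 ?addr0 => [|i' ii'].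
    rewrite (ball_poly_index_orthogonal i i) eqxx mulr1 divff ?scale1r//.
    exact: H_tilde_neq0.
  rewrite (ball_poly_index_orthogonal i i') eq_sym (negbTE ii').
  by rewrite mulr0 mul0r scale0r.
Qed.

Lemma ball_poly_basis n : is_basis (@orthopolys R d mu lambda n)
  (fun i : index n => bp (tagged i)).
Proof.
split.
- move=> i; split; first exact: msize_ball_poly.
  (* For n = 0 the only polynomial of size at most 0 is 0; for a successor, the induction principle
     in degree n - 1 applies. *)
  move=> g gn; rewrite ip_sym; case: n i gn => [|n] i gn.
    by move: gn; rewrite leqn0 mmeasure_poly_eq0 => /eqP->; rewrite ip0l.
  move: g gn; apply: span_msize.
  + exact: ip0l.
  + by move=> c f g f0 g0; rewrite ip_linl f0 g0 mulr0 addr0.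
  + move=> m j nu mn jm; rewrite ball_poly_orthogonal//.
    by rewrite (_ : (m == n.+1) = false) ?mulr0 ?mul0r//; lia.
- move=> c c0 i; have := ip0l (bp (tagged i)); rewrite -c0 ip_suml (bigD1 i)//= big1.
    rewrite addr0 ball_poly_index_orthogonal eqxx mulr1 => /eqP.
    by rewrite mulf_eq0 (negbTE (H_tilde_neq0 _ _)) orbF => /eqP.
  by move=> j ji; rewrite ball_poly_index_orthogonal (negbTE ji) !mulr0.
- move=> v [vn vo]; exists (fun i : index n =>
    ip v (bp (tagged i)) / H_tilde d mu lambda q n (tag i)).
  (* The blocks with m < n vanish because their polynomials have degree below n, to which [v] is
     orthogonal. *)
  rewrite -[LHS](fourierE vn) /fourier big_ord_recr/= big1 ?add0r// => m _.
  rewrite big1// => i _; rewrite vo ?mul0r ?scale0r//.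
  by apply: leq_trans (msize_ball_poly _ _) _; [exact: tag_le | exact: ltn_ord].
Qed.

End basis.

(* The number a k of elements of a basis of H_k^d is its dimension a_k^d. *)
Theorem theorem3p1 (R : realType) (d : nat) (mu lambda : R)
    (a : nat -> nat) (Y : forall k : nat, 'I_(a k) -> mpoly d R)
    (P q : nat -> nat -> {poly R})
    (d_ge2 : (2 <= d)%N) (mu_gtN1 : -1 < mu) (lambda_gt0 : 0 < lambda)
    (Y_basis : forall k : nat, is_basis (@harmonics R d k) (Y k))
    (Y_orthonormal : forall (k : nat) (nu eta : 'I_(a k)),
      sphere_ip (Y k nu) (Y k eta) = (nu == eta)%:R)
    (P_jacobi : forall k j : nat, is_jacobi mu (beta_ R d k) j (P k j))
    (q_orthopoly : forall k j : nat,
      is_orthopoly (jacobi_mass_ip mu (beta_ R d k) (M_ d mu lambda k)) j (q k j))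
    (q_lead_coef : forall k j : nat, lead_coef (q k j) = lead_coef (P k j)) :
  (forall n : nat,
    is_basis (@orthopolys R d mu lambda n)
      (fun i : {j : 'I_(n./2).+1 & 'I_(a (n - 2 * j)%N)} =>
         ball_poly Y q (tagged i))) /\
  (forall (n m j k : nat) (nu : 'I_(a (n - 2 * j)%N)) (eta : 'I_(a (m - 2 * k)%N)),
    (2 * j <= n)%N -> (2 * k <= m)%N ->
    ball_ip mu lambda (ball_poly Y q nu) (ball_poly Y q eta) =
      H_tilde d mu lambda q n j *
      (n == m)%:R * (j == k)%:R * (nu == eta :> nat)%:R).
Proof.
split=> [n|n m j k nu eta].
  exact: (ball_poly_basis d_ge2 mu_gtN1 lambda_gt0 Y_basis Y_orthonormal q_orthopoly).
exact: (ball_poly_orthogonal d_ge2 mu_gtN1 lambda_gt0 Y_basis Y_orthonormal q_orthopoly).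
Qed.
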